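(* Let $G$ be a simply connected nilpotent Lie group, $\Gamma\subset G$ a discrete subgroup with $M=G/\Gamma$ compact, and let $(J,\omega_0)$ be an invariant SKT structure on the nilmanifold $M$ (so $J$ is an invariant complex structure on $M$ and $\omega_0$ is the fundamental form of an invariant SKT metric on $(M,J)$). Then there exists a real number $\epsilon>0$ such that the solution $\omega(t)$ to the pluriclosed flow $$\frac{d}{dt}\omega=-(\rho^{B})^{1,1}(\omega),\qquad \omega(0)=\omega_0,$$ is defined for every $t\in(-\epsilon,\infty)$.
   Context: A tensor on $M=G/\Gamma$ is called invariant if it is induced by a left-invariant tensor on $G$. For a Hermitian manifold $(M,g,J)$ the fundamental form is $\omega(X,Y)=g(X,JY)$. The Hermitian metric $g$ (or the pair $(g,J)$, or $(J,\omega)$) is called SKT (strong Kähler with torsion), or pluriclosed, if $\partial\bar\partial\omega=0$. The Bismut connection $\nabla^B$ of $(g,J)$ is the unique connection with $\nabla^B g=0$, $\nabla^B J=0$ and such that $c(X,Y,Z):=g(X,T^B(Y,Z))$ is totally skew-symmetric, where $T^B(X,Y)=\nabla^B_XY-\nabla^B_YX-[X,Y]$. Put $R^B(X,Y)=[\nabla^B_X,\nabla^B_Y]-\nabla^B_{[X,Y]}$. The Bismut Ricci form is $$\rho^B(X,Y)=\tfrac12\sum_{k} g(R^B(X,Y)e_k,Je_k),$$ where $\{e_k\}$ is any local $g$-orthonormal real frame; it is written $\rho^B(\omega)$ for the metric with fundamental form $\omega$. Its $(1,1)$-part is $(\rho^B)^{1,1}(X,Y)=\tfrac12\big(\rho^B(X,Y)+\rho^B(JX,JY)\big)$.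 The unknown $\omega(t)$ of the pluriclosed flow is a family of fundamental forms of $J$-Hermitian metrics. Since the flow is invariant under biholomorphisms, for invariant $\omega_0$ the solution is invariant for every $t$, and the flow on $M$ is equivalent to an ODE system on the Lie algebra of $G$; the solution is understood in this sense. *)

(* Defs.v *)
From HB Require Import structures.
From mathcomp Require Import all_boot all_order all_algebra.
From mathcomp Require Import all_classical all_reals all_analysis.
From mathcomp Require Import generic_quotient complex.

Set Implicit Arguments.
Unset Strict Implicit.
Unset Printing Implicit Defensive.

Import Order.TTheory GRing.Theory Num.Theory numFieldNormedType.Exports.

Local Open Scope classical_set_scope.
Local Open Scope ring_scope.
Local Open Scope quotient_scope.

(* The algebraic and topological data only; their compatibility is part of
   lie_group below. *)
#[short(type="topGroupType")]
HB.structure Definition TopGroup := {G of Group G & Topological G}.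

Section Smooth.
Variable R : realType.

Definition iter_derive n (vs : seq 'rV[R]_n) (f : 'rV[R]_n -> R) :
    'rV[R]_n -> R :=
  foldr (fun v h x => 'D_v h x) f vs.

(* C^oo on an open set U: the iterated directional derivatives of all orders
   exist and are continuous at the points of U. *)
Definition smooth_on n (U : set 'rV[R]_n) (f : 'rV[R]_n -> R) : Prop :=
  forall vs x, U x ->
    {for x, continuous (iter_derive vs f)} /\
    forall v, derivable (iter_derive vs f) x v.

Definition smooth_map_on n m (U : set 'rV[R]_n)
    (f : 'rV[R]_n -> 'rV[R]_m) : Prop :=
  forall i : 'I_m, smooth_on U (fun x => f x ord0 i).

End Smooth.

Section LieGroup.
Variables (R : realType) (G : topGroupType) (n : nat).

(* coord is meaningful on dom, param on coord @` dom. *)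
Record chart := Chart {
  dom : set G;
  coord : G -> 'rV[R]_n;
  param : 'rV[R]_n -> G }.

Definition chart_image (c : chart) : set 'rV[R]_n := coord c @` dom c.

Definition is_chart (c : chart) : Prop :=
  [/\ open (dom c), open (chart_image c),
      forall x, dom c x -> param c (coord c x) = x,
      {within dom c, continuous (coord c)} &
      {within chart_image c, continuous (param c)}].

Definition smooth_atlas (A : set chart) : Prop :=
  [/\ forall c, A c -> is_chart c,
      forall x, exists2 c, A c & dom c x &
      forall c d, A c -> A d ->
        smooth_map_on [set v | chart_image c v /\ dom d (param c v)]
                      (fun v => coord d (param c v))].

Record lie_group (A : set chart) : Prop := LieGroup {
  lie_group_hausdorff : hausdorff_space G;
  lie_group_second_countable : @second_countable G;
  lie_group_atlas : smooth_atlas A;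
  lie_group_continuous_mul : continuous (fun p : G * G => (p.1 * p.2)%g);
  lie_group_continuous_inv : continuous (fun x : G => (x^-1)%g);
  lie_group_smooth_mul : forall a b c, A a -> A b -> A c ->
    smooth_map_on
      [set v : 'rV[R]_(n + n) |
        [/\ chart_image a (lsubmx v), chart_image b (rsubmx v) &
            dom c (param a (lsubmx v) * param b (rsubmx v))%g]]
      (fun v => coord c (param a (lsubmx v) * param b (rsubmx v))%g);
  lie_group_smooth_inv : forall a c, A a -> A c ->
    smooth_map_on
      [set v | chart_image a v /\ dom c ((param a v)^-1)%g]
      (fun v => coord c ((param a v)^-1)%g) }.

Definition smooth_fun (A : set chart) (f : G -> R) : Prop :=
  forall c, A c -> smooth_on (chart_image c) (fun v => f (param c v)).

(* Vector fields are derivations of C^oo(G); the values of D outside C^oo(G)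
   are irrelevant. *)
Record left_invariant_field (A : set chart) (D : (G -> R) -> (G -> R)) : Prop :=
  LeftInvariantField {
    field_smooth : forall f, smooth_fun A f -> smooth_fun A (D f);
    field_linear : forall (a : R) f h, smooth_fun A f -> smooth_fun A h ->
      forall x, D (fun y => a * f y + h y) x = a * D f x + D h x;
    field_leibniz : forall f h, smooth_fun A f -> smooth_fun A h ->
      forall x, D (fun y => f y * h y) x = D f x * h x + f x * D h x;
    field_left_invariant : forall f (z : G), smooth_fun A f ->
      forall x, D (fun y => f (z * y)%g) x = D f (z * x)%g }.

(* (L, br) is the Lie algebra of G: xi is a linear isomorphism of L onto the
   left-invariant vector fields, carrying br to the commutator. *)
Record lie_algebra_of (A : set chart) (L : vectType R) (br : L -> L -> L)
    (xi : L -> (G -> R) -> (G -> R)) : Prop := LieAlgebraOf {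
  lie_field : forall X, left_invariant_field A (xi X);
  lie_linear : forall (a : R) X Y f, smooth_fun A f ->
    forall x, xi (a *: X + Y) f x = a * xi X f x + xi Y f x;
  lie_injective : forall X,
    (forall f, smooth_fun A f -> forall x, xi X f x = 0) -> X = 0;
  lie_surjective : forall D, left_invariant_field A D ->
    exists X, forall f, smooth_fun A f -> forall x, xi X f x = D f x;
  lie_bracket : forall X Y f, smooth_fun A f ->
    forall x, xi (br X Y) f x = xi X (xi Y f) x - xi Y (xi X f) x }.

End LieGroup.

Section SimplyConnected.
Variables (R : realType) (T : topologicalType).

Let I : set R := `[0, 1].

Definition path_connected : Prop :=
  forall x y : T, exists c : R -> T,
    [/\ {within I, continuous c}, c 0 = x & c 1 = y].

Definition null_homotopic (c : R -> T) : Prop :=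
  exists H : R * R -> T,
    [/\ {within I `*` I, continuous H},
        forall s, I s -> H (s, 0) = c s,
        forall s, I s -> H (s, 1) = c 0 &
        forall t, I t -> H (0, t) = c 0 /\ H (1, t) = c 0].

Definition simply_connected : Prop :=
  path_connected /\
  forall c : R -> T, {within I, continuous c} -> c 0 = c 1 -> null_homotopic c.

End SimplyConnected.

Section Quotient.
Variables (G : topGroupType) (Gam : groupClosed G).

Definition discrete_subgroup : Prop :=
  forall x, x \in Gam -> isolated [set y | y \in Gam] x.

(* Gam acts by left translations, so that left-invariant tensors descend to the
   quotient; x ~ y iff y = z x for some z in Gam. *)
Definition orbit_rel (x y : G) : bool := (y * x^-1)%g \in Gam.

Lemma orbit_rel_equiv : equiv_class_of orbit_rel.
Proof.
split=> [x|x y|y x z]; rewrite /orbit_rel.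
- by rewrite mulgV gpred1.
- exact: gpredFC.
- move=> xy yz; rewrite -(mulgVK y z) -monoid.mulgA.
  exact: gpredM.
Qed.

Canonical orbit_rel_equivRel := EquivRelPack orbit_rel_equiv.

Definition orbit_space : topologicalType :=
  quotient_topology {eq_quot orbit_rel_equivRel}.

End Quotient.

(* Left-invariant tensors on G are given by their values on left-invariant
   vector fields, that is, by tensors on the Lie algebra L of G. *)

Section InvariantTensors.
Variables (R : realType) (L : vectType R) (br : L -> L -> L).

(* lower_central k is the (k+1)-st term of the lower central series. *)
Fixpoint lower_central (k : nat) : {vspace L} :=
  if k is k'.+1 then
    <<[seq br x y | x <- vbasis {:L}, y <- vbasis (lower_central k')]>>%VS
  else {:L}%VS.

Definition nilpotent_lie_algebra : Prop := exists k, lower_central k = 0%VS.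

Definition bilinear_form (b : L -> L -> R) : Prop :=
  (forall X, scalar (b X)) /\ (forall Y, scalar (b^~ Y)).

Definition inner_product (g : L -> L -> R) : Prop :=
  [/\ bilinear_form g, forall X Y, g X Y = g Y X &
      forall X, X != 0 -> 0 < g X X].

Variable J : 'End(L).

Definition nijenhuis (X Y : L) : L :=
  br (J X) (J Y) - J (br (J X) Y) - J (br X (J Y)) - br X Y.

Definition complex_structure : Prop :=
  (forall X, J (J X) = - X) /\ (forall X Y, nijenhuis X Y = 0).

Definition hermitian_metric (g : L -> L -> R) : Prop :=
  inner_product g /\ forall X Y, g (J X) (J Y) = g X Y.

Definition fundamental_form (g : L -> L -> R) (X Y : L) : R := g X (J Y).

(* Complex-valued k-forms, as functions of k arguments in L. *)
Definition form (k : nat) : Type := ('I_k -> L) -> R[i].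

(* The exterior derivative on left-invariant forms,
   sum_(i<j) (-1)^(i+j) a([x_i,x_j], x_0, .., ^x_i, .., ^x_j, .., x_k);
   moving the bracket to the place of x_i turns the sign into (-1)^j. *)
Definition ext_d k (a : form k) : form k.+1 := fun x =>
  \sum_(i < k.+1) \sum_(j < k.+1 | (i < j)%N)
    (-1) ^+ j *
    a (fun l => if lift j l == i then br (x i) (x j) else x (lift j l)).

(* Precomposition, in the argument j, with the projection X |-> (X - iJX)/2
   onto L^{1,0} (if b) or X |-> (X + iJX)/2 onto L^{0,1} (if not b), a being
   extended complex-multilinearly. *)
Definition slot_proj k (j : 'I_k) (b : bool) (a : form k) : form k := fun x =>
  2^-1 * (a x + (if b then - 'i%C else 'i%C) *
                a (fun l => if l == j then J (x l) else x l)).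

(* The component of type (p, k - p). *)
Definition type_part k (p : nat) (a : form k) : form k := fun x =>
  \sum_(S : {set 'I_k} | #|S| == p)
    foldr (fun j b => slot_proj j (j \in S) b) a (enum 'I_k) x.

Definition del k (a : form k) : form k.+1 := fun x =>
  \sum_(p < k.+1) type_part p.+1 (ext_d (type_part p a)) x.

Definition delbar k (a : form k) : form k.+1 := fun x =>
  \sum_(p < k.+1) type_part p (ext_d (type_part p a)) x.

Definition complex_form2 (w : L -> L -> R) : form 2 := fun x =>
  real_complex R (w (x ord0) (x ord_max)).

Definition skt_structure (w : L -> L -> R) : Prop :=
  [/\ complex_structure,
      exists2 g, hermitian_metric g & forall X Y, w X Y = fundamental_form g X Y &
      forall x, del (delbar (complex_form2 w)) x = 0].

(* A left-invariant connection is a bilinear map L -> L -> L. Functions such as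
   g Y Z are constant on G for left-invariant Y and Z. *)
Definition torsion (nabla : L -> L -> L) (X Y : L) : L :=
  nabla X Y - nabla Y X - br X Y.

Record bismut_connection (g : L -> L -> R) (nabla : L -> L -> L) : Prop :=
  BismutConnection {
    bismut_linearl : forall Y, linear (nabla^~ Y);
    bismut_linearr : forall X, linear (nabla X);
    bismut_metric : forall X Y Z, g (nabla X Y) Z + g Y (nabla X Z) = 0;
    bismut_complex : forall X Y, nabla X (J Y) = J (nabla X Y);
    bismut_skew : forall X Y Z,
      g X (torsion nabla Y Z) = - g Y (torsion nabla X Z) /\
      g X (torsion nabla Y Z) = - g X (torsion nabla Z Y) }.

Definition curvature (nabla : L -> L -> L) (X Y Z : L) : L :=
  nabla X (nabla Y Z) - nabla Y (nabla X Z) - nabla (br X Y) Z.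

Definition orthonormal_frame (g : L -> L -> R) (e : 'I_(\dim {:L}) -> L) : Prop :=
  forall i j, g (e i) (e j) = (i == j)%:R.

Definition bismut_ricci_form (g rho : L -> L -> R) : Prop :=
  exists2 nabla, bismut_connection g nabla &
  forall e, orthonormal_frame g e -> forall X Y,
    rho X Y = 2^-1 * \sum_k g (curvature nabla X Y (e k)) (J (e k)).

Definition part11 (rho : L -> L -> R) (X Y : L) : R :=
  2^-1 * (rho X Y + rho (J X) (J Y)).

Definition pluriclosed_flow (I : set R) (w : R -> L -> L -> R) : Prop :=
  forall t, I t -> exists g rho,
    [/\ hermitian_metric g,
        forall X Y, w t X Y = fundamental_form g X Y,
        bismut_ricci_form g rho &
        forall X Y, is_derive t 1 (fun s => w s X Y) (- part11 rho X Y)].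

End InvariantTensors.

(* Main.v *)
Require Import Defs.
From HB Require Import structures.
From mathcomp Require Import all_boot all_order all_algebra.
From mathcomp Require Import all_classical all_reals all_analysis.
From mathcomp Require Import complex ring lra.

Set Implicit Arguments.
Unset Strict Implicit.
Unset Printing Implicit Defensive.

Import Order.TTheory GRing.Theory Num.Theory numFieldNormedType.Exports.

Local Open Scope classical_set_scope.
Local Open Scope ring_scope.

(* On left-invariant tensors the SKT condition says that the torsion 3-form
   c(X, Y, Z) = g([JX, JY], Z) + g([JY, JZ], X) + g([JZ, JX], Y) is closed.

   A nilpotent Lie algebra with an SKT structure is 2-step with J-invariant
   center: this is proved by induction on J-invariant subalgebras k.  Some
   J-invariant ideal h of real codimension 2 contains [k, k] (Salamon), and
   k = h + <A, JA>.  By induction h is 2-step.  Summing dc(X, JX, A, JA) = 0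
   over an orthonormal basis of the center z of h gives a trace inequality for
   ad A and ad JA which, since these are commuting and nilpotent, makes them
   vanish on z.  With S the sum of [e, Je] over an orthonormal basis of h, the
   exact form Om(X, Y) = g([X, Y], S) then tames J on h / z.  Choose A
   Om-orthogonal to h.  If Om(A, JA) <= 0, the trace inequality on h makes A and
   JA commute with h; if Om(A, JA) > 0, then Om tames J on the nilpotent algebra
   k / z, which forces k / z to be abelian.

   For a 2-step algebra rho^B(X, Y) = g([X, Y], S_g) / 2 with S_g the sum of
   [e, Je] over a g-orthonormal basis.  So the flow moves g only along
   g_U = g_0 + g_0(beta, U) / 2, beta(X, Y) = ([X, JY] - [JX, Y]) / 2, and it
   becomes the equation U' = S_{g_U} in a finite-dimensional space.  The SKT
   condition gives g_0([X, JX], [Y, JY]) >= 0, so g_U is nondecreasing in time;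
   hence g_U >= g_0 / 2 on all of (-eps, oo), a region on which the right-hand
   side is bounded and Lipschitz, and Picard iteration converges there. *)

(** * Orthonormal bases *)

Section BilinearForms.
Variables (R : realType) (L : vectType R).
Implicit Types (b : L -> L -> R) (X Y Z : L) (F : {vspace L}).

Lemma formDl b X Y Z : bilinear_form b -> b (X + Y) Z = b X Z + b Y Z.
Proof. by move=> [_ h]; have := h Z 1 X Y; rewrite scale1r mul1r. Qed.

Lemma formDr b X Y Z : bilinear_form b -> b X (Y + Z) = b X Y + b X Z.
Proof. by move=> [h _]; have := h X 1 Y Z; rewrite scale1r mul1r. Qed.

Lemma form0l b Z : bilinear_form b -> b 0 Z = 0.
Proof. by move=> hb; have := formDl 0 0 Z hb; rewrite addr0; lra. Qed.

Lemma form0r b X : bilinear_form b -> b X 0 = 0.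
Proof. by move=> hb; have := formDr X 0 0 hb; rewrite addr0; lra. Qed.

Lemma formZl b a X Z : bilinear_form b -> b (a *: X) Z = a * b X Z.
Proof.
by move=> hb; have [_ h] := hb; have := h Z a X 0; rewrite !addr0 form0l // addr0.
Qed.

Lemma formZr b a X Z : bilinear_form b -> b X (a *: Z) = a * b X Z.
Proof.
by move=> hb; have [h _] := hb; have := h X a Z 0; rewrite !addr0 form0r // addr0.
Qed.

Lemma formNl b X Z : bilinear_form b -> b (- X) Z = - b X Z.
Proof. by move=> hb; rewrite -scaleN1r formZl // mulN1r. Qed.

Lemma formNr b X Z : bilinear_form b -> b X (- Z) = - b X Z.
Proof. by move=> hb; rewrite -scaleN1r formZr // mulN1r. Qed.

Lemma form_suml b I (r : seq I) (P : pred I) (x : I -> L) Z : bilinear_form b ->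
  b (\sum_(i <- r | P i) x i) Z = \sum_(i <- r | P i) b (x i) Z.
Proof.
move=> hb; apply: (big_morph (b^~ Z)); first by move=> *; rewrite formDl.
exact: form0l.
Qed.

Lemma form_sumr b I (r : seq I) (P : pred I) X (z : I -> L) : bilinear_form b ->
  b X (\sum_(i <- r | P i) z i) = \sum_(i <- r | P i) b X (z i).
Proof.
move=> hb; apply: (big_morph (b X)); first by move=> *; rewrite formDr.
exact: form0r.
Qed.

Definition formE b (hb : bilinear_form b) :=
  (fun X Y Z => formDl X Y Z hb, fun X Y Z => formDr X Y Z hb,
   fun X Z => formNl X Z hb, fun X Z => formNr X Z hb,
   fun a X Z => formZl a X Z hb, fun a X Z => formZr a X Z hb,
   fun Z => form0l Z hb, fun X => form0r X hb).

Lemma linear_comb (V : lmodType R) (T : L -> V) I (r : seq I) (a : I -> R) x :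
  linear T -> T (\sum_(i <- r) a i *: x i) = \sum_(i <- r) a i *: T (x i).
Proof.
move=> lT; elim: r => [|i r IH]; rewrite ?big_nil ?big_cons ?lT ?IH //.
by have := lT (- 1) 0 0; rewrite scaler0 addr0 scaleN1r addNr.
Qed.

(** Spanning is given by the expansion formula, and [d] is a free parameter, so that two bases of
    the same subspace can be compared without casts. *)
Definition onb b F (d : nat) (e : 'I_d -> L) : Prop :=
  [/\ forall i, e i \in F, forall i j, b (e i) (e j) = (i == j)%:R &
      forall X, X \in F -> X = \sum_i b X (e i) *: e i].

(** Gram-Schmidt by induction on the dimension: a normalised vector u of F is split off, and the
    induction applies to the kernel of b(u, .) in F. Positivity is asked on F only, because later
    forms are definite only on a subspace. *)
Lemma onb_exists b F : bilinear_form b -> (forall X Y, b X Y = b Y X) ->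
  (forall X, X \in F -> X != 0 -> 0 < b X X) ->
  exists e : 'I_(\dim F) -> L, onb b F e.
Proof.
move=> hb sb; move dF: (\dim F) => d; elim: d F dF => [|d IH] F dF pb.
  exists (fun _ => 0); split=> [[]//|[]//|X].
  move/eqP: dF; rewrite dimv_eq0 => /eqP ->; rewrite memv0 => /eqP ->.
  by rewrite big_ord0.
have F0 : F != 0%VS by rewrite -dimv_eq0 dF.
have v0 : vpick F != 0 by rewrite vpick0.
have vF : vpick F \in F by exact: memv_pick.
pose v := vpick F; have vp : 0 < b v v by apply: pb.
pose u := (Num.sqrt (b v v))^-1 *: v.
have uF : u \in F by rewrite memvZ.
have uu : b u u = 1.
  rewrite !(formE hb) mulrA -invfM -expr2 sqr_sqrtr ?(ltW vp) // mulVf //.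
  by rewrite gt_eqF.
clearbody u; clear v vp v0 vF.
pose f : {linear L -> R^o} :=
  HB.pack (b u) (GRing.isLinear.Build R L R^o *%R (b u) (proj1 hb u)).
have fE X : linfun f X = b u X by rewrite lfunE.
pose F' := (F :&: lker (linfun f))%VS.
have F'P X : (X \in F') = (X \in F) && (b u X == 0).
  by rewrite memv_cap memv_ker fE.
have dF' : \dim F' = d.
  have := limg_ker_dim (linfun f) F; rewrite dF -/F'.
  (* Rank-nullity: b(u, .) maps F onto the scalars since b(u, u) = 1, so its kernel in F has
     codimension 1. *)
  suff -> : (linfun f @: F)%VS = fullv.
    by rewrite dimvf /= addn1 => -[].
  apply/eqP; rewrite eqEsubv subvf /=; apply/subvP => r _.
  have -> : r = linfun f (r *: u) by rewrite fE formZr // uu mulr1.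
  by rewrite memv_img // memvZ.
have [|e [eF eo eX]] := IH F' dF'.
  by move=> X; rewrite F'P => /andP[XF _]; exact: pb.
have eu j : b u (e j) = 0 by have := eF j; rewrite F'P => /andP[_ /eqP].
exists (fun i => if unlift ord0 i is Some j then e j else u); split.
- by move=> i; case: unliftP => [j _|_] //; have := eF j; rewrite F'P => /andP[].
- move=> i j; case: unliftP => [i' ->|->]; case: unliftP => [j' ->|->].
  + by rewrite eo (inj_eq lift_inj).
  + by rewrite sb eu eq_sym (negbTE (neq_lift _ _)).
  + by rewrite eu (negbTE (neq_lift _ _)).
  + by rewrite uu eqxx.
- move=> X XF; rewrite big_ord_recl unlift_none.
  under eq_bigr do rewrite liftK.
  have XF' : X - b X u *: u \in F'.
    by rewrite F'P memvB ?memvZ //= !(formE hb) uu mulr1 sb subrr.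
  rewrite -[LHS](subrK (b X u *: u)) addrC; congr (_ + _).
  rewrite [LHS](eX _ XF'); apply: eq_bigr => i _.
  by rewrite !(formE hb) eu mulr0 subr0.
Qed.

Lemma onb_parseval b F d (e : 'I_d -> L) X Y : bilinear_form b ->
  onb b F e -> X \in F -> Y \in F -> (forall X Y, b X Y = b Y X) ->
  b X Y = \sum_i b X (e i) * b Y (e i).
Proof.
move=> hb [_ eo eX] XF YF sb; rewrite {1}(eX _ XF) form_suml //.
by apply: eq_bigr => i _; rewrite formZl // (sb (e i)).
Qed.

(** The trace of a bilinear map does not depend on the orthonormal basis: expand each e_i in f,
    exchange the sums, and resum using the expansion of f_j in e. *)
Lemma onb_contraction b F d d' (e : 'I_d -> L) (f : 'I_d' -> L) (V : lmodType R)
    (h : L -> L -> V) : bilinear_form b -> (forall X Y, b X Y = b Y X) ->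
  (forall Z, linear (h^~ Z)) -> (forall X, linear (h X)) ->
  onb b F e -> onb b F f -> \sum_i h (e i) (e i) = \sum_i h (f i) (f i).
Proof.
move=> hb sb hl hr [eF eo eX] [fF fo fX].
under eq_bigr => i _ do rewrite {1}(fX _ (eF i)) (linear_comb _ _ _ (hl _)).
rewrite exchange_big /=; apply: eq_bigr => j _.
rewrite [in RHS](eX _ (fF j)) (linear_comb _ _ _ (hl _)).
transitivity (\sum_i b (f j) (e i) *: h (f j) (e i)).
  by apply: eq_bigr => i _; rewrite sb.
by rewrite -(linear_comb _ _ _ (hr _)) -(eX _ (fF j)) {1}(eX _ (fF j))
  (linear_comb _ _ _ (hl _)).
Qed.

Lemma frame_onb b (e : 'I_(\dim {:L}) -> L) : bilinear_form b ->
  orthonormal_frame b e -> onb b {:L}%VS e.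
Proof.
move=> hb eo; split=> [i|//|X _]; first exact: memvf.
pose s := [tuple e i | i < \dim {:L}].
have sE (i : 'I_(\dim {:L})) : s`_i = e i.
  by rewrite -tnth_nth tnth_mktuple.
have fs : free s.
  apply/freeP => k k0 i.
  have : b (\sum_(i < \dim {:L}) k i *: s`_i) (e i) = 0 by rewrite k0 form0l.
  rewrite form_suml // (bigD1 i) //= big1 ?addr0.
    by rewrite sE formZl // eo eqxx mulr1.
  by move=> j ji; rewrite sE formZl // eo (negbTE ji) mulr0.
have : basis_of {:L}%VS s by rewrite basisEfree fs subvf size_tuple leqnn.
move=> bs; have := coord_basis bs (memvf X) => XE.
rewrite {1}XE; apply: eq_bigr => i _; rewrite sE; congr (_ *: _).
rewrite {2}XE form_suml // (bigD1 i) //= big1 ?addr0.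
  by rewrite sE formZl // eo eqxx mulr1.
by move=> j ji; rewrite sE formZl // eo (negbTE ji) mulr0.
Qed.

End BilinearForms.

(** * A trace inequality *)

Section Trace.
Variable R : realType.

(** X - M divides X^k - M^k = X^k among matrices of polynomials, so by determinants the
    characteristic polynomial divides a power of X. Being monic it is X^d, whose subleading
    coefficient, minus the trace, is 0. *)
Lemma mxtrace_nilpotent d (M : 'M[R]_d) k : M ^+ k = 0 -> \tr M = 0.
Proof.
case: d M => [|d] M Mk; first by rewrite /mxtrace big_ord0.
have [m hm] : exists m, char_poly M %| ('X - 0%:P) ^+ m.
  exists (k * d.+1)%N; rewrite subr0.
  have cX : GRing.comm ('X%:M : 'M[{poly R}]_d.+1) (map_mx polyC M).
    by rewrite /GRing.comm -!mulmxE scalar_mxC.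
  have := subrXX_comm k cX.
  have -> : map_mx (@polyC R) M ^+ k = 0.
    by rewrite -(rmorphXn (map_mx (@polyC R))) /= Mk map_mx0.
  rewrite subr0 -rmorphXn /= => /(congr1 determinant).
  rewrite det_scalar -exprM -mulmxE det_mulmx => ->.
  exact: dvdp_mulr.
have [j _ hj] := dvdp_exp_XsubCP hm.
have cE : char_poly M = 'X^j.
  apply/eqP; rewrite subr0 in hj.
  by rewrite -eqp_monic // ?char_poly_monic ?monicXn.
have jd : j = d.+1.
  by have := size_char_poly M; rewrite cE size_polyXn => -[].
have := char_poly_trace M (ltn0Sn d).
rewrite cE jd coefXn /= (ltn_eqF (ltnSn d)).
by move/eqP; rewrite eq_sym oppr_eq0 => /eqP.
Qed.

Lemma mxtrace_mul_tr_eq0 m n (M : 'M[R]_(m, n)) :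
  \tr (M^T *m M) <= 0 -> M = 0.
Proof.
have E : \tr (M^T *m M) = \sum_j \sum_i M i j ^+ 2.
  by apply: eq_bigr => j _; rewrite mxE; apply: eq_bigr => i _; rewrite mxE.
have s0 j : 0 <= \sum_i M i j ^+ 2 by apply: sumr_ge0 => i _; exact: sqr_ge0.
rewrite E => h; apply/matrixP => i j; rewrite mxE; apply/eqP.
have /eqP : \sum_j \sum_i M i j ^+ 2 = 0.
  by apply/eqP; rewrite eq_le h sumr_ge0.
rewrite psumr_eq0 // => /allP /(_ j (mem_index_enum _)) /=.
rewrite psumr_eq0; last by move=> *; exact: sqr_ge0.
by move=> /allP /(_ i (mem_index_enum _)) /=; rewrite sqrf_eq0.
Qed.

(* The left-hand side of the inequality is the sum of the squared norms of
   [M^T - JMJ] and [M'^T - JM'J]; once these vanish, the trace of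
   [J (M M' - M' M)] is the squared norm of [M]. *)
Lemma skew_pair_vanish d (J M M' : 'M[R]_d) :
  J^T = - J -> J *m J = - 1%:M ->
  M' *m J - M = J *m M' + J *m M *m J ->
  \tr (M *m M) = 0 -> \tr (M' *m M') = 0 ->
  \tr (J *m (M *m M' - M' *m M)) = 0 ->
  \tr (M^T *m M) + \tr (M'^T *m M')
    - \tr (M *m J *m M *m J) - \tr (M' *m J *m M' *m J) <= 0 ->
  M = 0 /\ M' = 0.
Proof.
move=> JT JJ rel t1 t2 tc le.
have sq (A : 'M[R]_d) : \tr ((A^T - J *m A *m J)^T *m (A^T - J *m A *m J)) =
    2 * (\tr (A^T *m A) - \tr (A *m J *m A *m J)).
  rewrite [(_ - _)^T]linearB /= trmxK !trmx_mul JT mulmxBl !mulmxBr.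
  rewrite !linearB /=.
  have -> : \tr (A *m A^T) = \tr (A^T *m A) by exact: mxtrace_mulC.
  have -> : \tr (A *m (J *m A *m J)) = \tr (A *m J *m A *m J).
    by rewrite !mulmxA.
  have -> : \tr (- J *m (A^T *m - J) *m A^T) = \tr (A *m J *m A *m J).
    rewrite !mulNmx !mulmxN mulNmx opprK -mxtrace_tr !trmx_mul trmxK JT.
    by rewrite !mulmxA !mulmxN !mulNmx opprK.
  have -> : \tr (- J *m (A^T *m - J) *m (J *m A *m J)) = \tr (A^T *m A).
    rewrite !mulNmx !mulmxN mulNmx !opprK.
    have -> : J *m (A^T *m J) *m (J *m A *m J) =
        J *m (A^T *m (J *m J) *m A *m J) by rewrite !mulmxA.
    rewrite JJ mxtrace_mulC -!mulmxA JJ mulmxN mulNmx mulmx1 mul1mx mulmxN.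
    by rewrite mulmxN opprK.
  by lra.
have n0 (A : 'M[R]_d) : 0 <= \tr (A^T *m A).
  rewrite /mxtrace; apply: sumr_ge0 => j _; rewrite mxE sumr_ge0 // => i _.
  by rewrite mxE -expr2 sqr_ge0.
have := sq M; have := sq M'.
have := n0 (M^T - J *m M *m J); have := n0 (M'^T - J *m M' *m J).
move=> p' p e' e.
have /mxtrace_mul_tr_eq0/subr0_eq MT :
  \tr ((M^T - J *m M *m J)^T *m (M^T - J *m M *m J)) <= 0 by lra.
have /mxtrace_mul_tr_eq0/subr0_eq M'T :
  \tr ((M'^T - J *m M' *m J)^T *m (M'^T - J *m M' *m J)) <= 0 by lra.
have relE : M' *m J = M + J *m M' + J *m M *m J by rewrite -addrA -rel addrC subrK.
have M0 : M = 0.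
  apply: mxtrace_mul_tr_eq0; rewrite MT.
  move: tc; rewrite mulmxBr linearB /=.
  rewrite (_ : \tr (J *m (M *m M')) = \tr (M *m (M' *m J))); last first.
    by rewrite mxtrace_mulC mulmxA.
  rewrite relE !mulmxDr !linearD /= t1.
  rewrite (_ : \tr (M *m (J *m M')) = \tr (J *m (M' *m M))); last first.
    by rewrite mxtrace_mulC -mulmxA.
  rewrite (_ : \tr (M *m (J *m M *m J)) = \tr (J *m M *m J *m M)); last first.
    by rewrite mxtrace_mulC.
  by lra.
(* Once M = 0, the relation says that M' commutes with J, so M'^T = J M' J = - M' and the squared
   norm of M' is - tr(M' M') = 0. *)
split=> //; apply: mxtrace_mul_tr_eq0; rewrite M'T.
move: relE; rewrite M0 add0r mulmx0 mul0mx addr0 => <-.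
by rewrite -(mulmxA M') JJ mulmxN mulmx1 mulNmx linearN /= t2 oppr0.
Qed.

End Trace.

(** * The trace inequality on an invariant subspace *)

Section AdaptedTrace.
Variables (R : realType) (L : vectType R) (g : L -> L -> R) (J : 'End(L)).
Hypothesis hg : bilinear_form g.
Hypothesis sg : forall X Y, g X Y = g Y X.
Hypothesis JJ : forall X, J (J X) = - X.
Hypothesis gJ : forall X Y, g (J X) (J Y) = g X Y.
Variables (F : {vspace L}) (d : nat) (e : 'I_d -> L).
Hypothesis he : onb g F e.

Definition coord_mx (T : L -> L) : 'M[R]_d := \matrix_(i, j) g (T (e j)) (e i).

Lemma coord_mxM (T T' : L -> L) : linear T -> (forall X, X \in F -> T' X \in F) ->
  coord_mx (fun X => T (T' X)) = coord_mx T *m coord_mx T'.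
Proof.
move=> lT T'F; have [eF eo eX] := he.
apply/matrixP => i j; rewrite !mxE.
rewrite {1}(eX _ (T'F _ (eF j))) (linear_comb _ _ _ lT) form_suml //.
by apply: eq_bigr => k _; rewrite formZl // !mxE mulrC.
Qed.

Lemma coord_mx0 (T : L -> L) : (forall X, X \in F -> T X \in F) ->
  coord_mx T = 0 -> forall X, linear T -> X \in F -> T X = 0.
Proof.
move=> TF T0 X lT XF; have [eF eo eX] := he.
rewrite (eX _ XF) (linear_comb _ _ _ lT) big1 // => i _.
rewrite (eX _ (TF _ (eF i))) big1 ?scaler0 // => j _.
by have /matrixP/(_ j i) := T0; rewrite !mxE => ->; rewrite scale0r.
Qed.

Lemma trace_coord_mx (T : L -> L) : \tr (coord_mx T) = \sum_i g (T (e i)) (e i).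
Proof. by apply: eq_bigr => i _; rewrite mxE. Qed.

Lemma trace_nilpotent (T : L -> L) k : linear T ->
  (forall X, X \in F -> T X \in F) -> (forall X, X \in F -> iter k T X = 0) ->
  \tr (coord_mx T) = 0.
Proof.
move=> lT TF Tk; apply: (@mxtrace_nilpotent _ _ _ k).
have [eF _ _] := he.
have -> : coord_mx T ^+ k = coord_mx (iter k T).
  elim: k {Tk} => [|k IH].
    have [_ eo _] := he.
    by apply/matrixP => i j; rewrite expr0 !mxE /= eo eq_sym.
  rewrite exprS IH -mulmxE -coord_mxM // => X XF.
  by elim: k {IH} => //= k IH; apply: TF.
by apply/matrixP => i j; rewrite !mxE Tk // form0l.
Qed.

Lemma trace_tr_mul (T : L -> L) : (forall X, X \in F -> T X \in F) ->
  \tr ((coord_mx T)^T *m coord_mx T) = \sum_i g (T (e i)) (T (e i)).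
Proof.
move=> TF; apply: eq_bigr => i _; have [eF _ _] := he.
rewrite mxE (onb_parseval hg he (TF _ (eF i)) (TF _ (eF i)) sg).
by apply: eq_bigr => j _; rewrite !mxE.
Qed.

Variables N N' : L -> L.
Hypothesis lN : linear N.
Hypothesis lN' : linear N'.

(** Summed over an orthonormal basis of a subspace stable under J, N and N', this is twice the
    left-hand side of the inequality in [skew_pair_vanish]. Each trace appears once at X and once at
    JX, the shape in which dc(X, JX, A, JA) produces it. *)
Definition pair_defect X : R :=
  g (N X) (N X) + g (N' X) (N' X) + g (N (J X)) (N (J X)) + g (N' (J X)) (N' (J X))
  + g (N (J (N X))) (J X) + g (N' (J (N' X))) (J X)
  - g (N (J (N (J X)))) X - g (N' (J (N' (J X)))) X.

(** [skew_pair_vanish] for the matrices of N and N' on F. The three trace conditions come from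
    nilpotency: of N and N', hence of their squares, and of J [N, N'], whose square is 0. *)
Lemma pair_vanish k : (forall X, X \in F -> J X \in F) ->
  (forall X, X \in F -> N X \in F) -> (forall X, X \in F -> N' X \in F) ->
  (forall X, X \in F -> N' (J X) - N X = J (N' X) + J (N (J X))) ->
  (forall X, X \in F -> iter k N X = 0) -> (forall X, X \in F -> iter k N' X = 0) ->
  (let T X := J (N (N' X) - N' (N X)) in forall X, X \in F -> T (T X) = 0) ->
  \sum_i pair_defect (e i) <= 0 ->
  forall X, X \in F -> N X = 0 /\ N' X = 0.
Proof.
move=> JF NF N'F rel Nk N'k T2 le.
have [eF eo eX] := he.
have lJ : linear J by move=> a X Y; rewrite linearP.
have cM := coord_mxM.
pose j := coord_mx J; pose M := coord_mx N; pose M' := coord_mx N'.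
have jT : j^T = - j.
  apply/matrixP => a b; rewrite !mxE -gJ JJ formNl // sg //.
have jj : j *m j = - 1%:M.
  rewrite -cM //; apply/matrixP => a b.
  by rewrite !mxE JJ formNl // eo eq_sym.
have sq T : linear T -> (forall X, X \in F -> T X \in F) ->
    (forall X, X \in F -> iter k T X = 0) -> \tr (coord_mx T *m coord_mx T) = 0.
  move=> lT TF Tk; rewrite -cM //.
  apply: (@trace_nilpotent (fun X => T (T X)) k).
  - by move=> a X Y; rewrite !lT.
  - by move=> X XF; do 2!apply: (TF).
  - have T0 : T 0 = 0 by have := lT (- 1) 0 0; rewrite scaler0 addr0 scaleN1r addNr.
    have it m X : iter m (fun X => T (T X)) X = iter m T (iter m T X).
      by rewrite -iterD addnn; elim: m => // m IH; rewrite doubleS !iterS IH.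
    have it0 m : iter m T 0 = 0 by elim: m => // m IH; rewrite iterS IH.
    by move=> X XF; rewrite it (Tk _ XF) it0.
have [|||||M0 M'0] := @skew_pair_vanish _ _ j M M' jT jj.
- rewrite -!cM //; last by move=> a X Y; rewrite lN lJ.
  apply/matrixP => a b; rewrite !mxE.
  by rewrite -(formNl (N (e b))) // -formDl // rel // formDl.
- exact: sq.
- exact: sq.
- rewrite -!cM //.
  have -> : coord_mx (fun X => N (N' X)) - coord_mx (fun X => N' (N X)) =
      coord_mx (fun X => N (N' X) - N' (N X)).
    by apply/matrixP => a b; rewrite !mxE !(formE hg).
  have TF X : X \in F -> N (N' X) - N' (N X) \in F.
    by move=> XF; rewrite memvB ?NF ?N'F ?NF ?N'F.
  rewrite -cM //; apply: (@trace_nilpotent _ 2).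
  + move=> a X Y; rewrite lN' (lN a X) lN lN' -linearP; congr (J _).
    by rewrite scalerBr opprD addrACA.
  + by move=> X XF; apply: JF; apply: TF.
  + by move=> X XF /=; exact: T2.
- suff E : \sum_i pair_defect (e i) = 2 * (\tr (M^T *m M) + \tr (M'^T *m M')
      - \tr (M *m j *m M *m j) - \tr (M' *m j *m M' *m j)) by lra.
  (* J is an isometry of F, so evaluating at JX instead of X gives the same traces up to sign; this
     accounts for the factor 2. *)
  have half T : linear T -> (forall X, X \in F -> T X \in F) ->
      \sum_i (g (T (e i)) (T (e i)) + g (T (J (e i))) (T (J (e i)))
        + g (T (J (T (e i)))) (J (e i)) - g (T (J (T (J (e i))))) (e i))
      = 2 * (\tr ((coord_mx T)^T *m coord_mx T)
        - \tr (coord_mx T *m j *m coord_mx T *m j)).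
    move=> lT TF; rewrite sumrB !big_split /= -trace_tr_mul //.
    have -> : \sum_i g (T (J (e i))) (T (J (e i))) =
        \tr ((coord_mx T)^T *m coord_mx T).
      rewrite -(trace_tr_mul (T := fun X => T (J X))); last first.
        by move=> X XF; apply: TF; apply: JF.
      rewrite cM // trmx_mul jT mxtrace_mulC mulmxA -(mulmxA _ j) mulmxN jj.
      by rewrite opprK mulmx1 mxtrace_mulC.
    have -> : \sum_i g (T (J (T (e i)))) (J (e i)) =
        - \tr (coord_mx T *m j *m coord_mx T *m j).
      rewrite mxtrace_mulC -!mulmxA -!cM // => [|X XF|X XF].
      - rewrite trace_coord_mx -sumrN; apply: eq_bigr => i _.
        by rewrite -[LHS]gJ JJ formNr.
      - by apply: (TF); apply: JF; apply: TF.
      - by apply: JF; apply: TF.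
    have -> : \sum_i g (T (J (T (J (e i))))) (e i) =
        \tr (coord_mx T *m j *m coord_mx T *m j).
      rewrite -!mulmxA -!cM ?trace_coord_mx // => X XF.
        by apply: (JF); apply: TF; apply: JF.
      by apply: TF; apply: JF.
    by lra.
  rewrite mulrDr.
  have -> : \sum_i pair_defect (e i) =
     \sum_i ((g (N (e i)) (N (e i)) + g (N (J (e i))) (N (J (e i)))
        + g (N (J (N (e i)))) (J (e i)) - g (N (J (N (J (e i))))) (e i)) +
      (g (N' (e i)) (N' (e i)) + g (N' (J (e i))) (N' (J (e i)))
        + g (N' (J (N' (e i)))) (J (e i)) - g (N' (J (N' (J (e i))))) (e i))).
    by apply: eq_bigr => i _; rewrite /pair_defect; ring.
  rewrite big_split /= !half //; lra.
by move=> X XF; split; apply: coord_mx0.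
Qed.
End AdaptedTrace.

(** * Subspaces cut out by predicates, and orthogonal projections *)

Section Subspaces.
Variables (R : realType) (L : vectType R).

(** V is a subspace of maximal dimension among those contained in P; a vector of P outside V would
    enlarge it. *)
Lemma vspace_of_pred (P : L -> Prop) : P 0 ->
  (forall a X Y, P X -> P Y -> P (a *: X + Y)) ->
  exists V : {vspace L}, forall X, X \in V <-> P X.
Proof.
move=> P0 PD.
pose Q n := `[< exists2 V : {vspace L}, \dim V = n & forall X, X \in V -> P X >].
have Q0 : exists n, Q n.
  exists 0%N; apply/asboolP; exists 0%VS; first exact: dimv0.
  by move=> X; rewrite memv0 => /eqP ->.
have Qb n : Q n -> (n <= \dim {:L})%N by move=> /asboolP[V <- _]; exact: dimvS (subvf _).
case: (ex_maxnP Q0 Qb) => n /asboolP[V dV VP] nmax.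
exists V => X; split; first exact: VP.
move=> PX; apply: contrapT => /negP XV.
have dVX : (\dim V < \dim (V + <[X]>))%N.
  rewrite ltnNge; apply: contra XV => le.
  have /eqP -> : V == (V + <[X]>)%VS by rewrite eqEdim addvSl.
  by rewrite memvE addvSr.
suff /nmax : Q (\dim (V + <[X]>)) by rewrite -dV leqNgt dVX.
apply/asboolP; exists (V + <[X]>)%VS => // Y /memv_addP[v vV [w /vlineP[a ->] ->]].
by rewrite addrC; apply: PD => //; exact: VP.
Qed.

Lemma orthogonal_projection (b : L -> L -> R) (F : {vspace L}) X :
  bilinear_form b -> (forall X Y, b X Y = b Y X) ->
  (forall X, X \in F -> X != 0 -> 0 < b X X) ->
  exists2 Y, Y \in F & forall Z, Z \in F -> b (X - Y) Z = 0.
Proof.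
move=> hb sb pb; have [e [eF eo eX]] := onb_exists hb sb pb.
exists (\sum_i b X (e i) *: e i).
  by apply: memv_suml => i _; rewrite memvZ.
move=> Z ZF; rewrite (eX _ ZF) form_sumr // big1 // => i _.
rewrite formZr // formDl // formNl // form_suml // (bigD1 i) //= big1.
  by rewrite formZl // eo eqxx mulr1 addr0 subrr mulr0.
by move=> j ji; rewrite formZl // eo (negbTE ji) mulr0.
Qed.

End Subspaces.

(** * Bilinear brackets *)

Section Bracket.
Variables (R : realType) (L : vectType R) (br : L -> L -> L).
Hypothesis brl : forall Z, linear (br^~ Z).
Hypothesis brr : forall X, linear (br X).

Lemma brDl X Y Z : br (X + Y) Z = br X Z + br Y Z.
Proof. by have := brl Z 1 X Y; rewrite !scale1r. Qed.

Lemma brDr X Y Z : br X (Y + Z) = br X Y + br X Z.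
Proof. by have := brr X 1 Y Z; rewrite !scale1r. Qed.

Lemma br0l Z : br 0 Z = 0.
Proof. by apply: (addrI (br 0 Z)); rewrite -brDl !addr0. Qed.

Lemma br0r X : br X 0 = 0.
Proof. by apply: (addrI (br X 0)); rewrite -brDr !addr0. Qed.

Lemma brZl a X Z : br (a *: X) Z = a *: br X Z.
Proof. by have := brl Z a X 0; rewrite !addr0 br0l addr0. Qed.

Lemma brZr a X Z : br X (a *: Z) = a *: br X Z.
Proof. by have := brr X a Z 0; rewrite !addr0 br0r addr0. Qed.

Lemma brNl X Z : br (- X) Z = - br X Z.
Proof. by rewrite -scaleN1r brZl scaleN1r. Qed.

Lemma brNr X Z : br X (- Z) = - br X Z.
Proof. by rewrite -scaleN1r brZr scaleN1r. Qed.

Definition brE := (brDl, brDr, brNl, brNr, brZl, brZr, br0l, br0r).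

(** Written as in [lower_central], so that a step of the lower central series unfolds to
    [bracket_span] of the whole space and the previous term. *)
Definition bracket_span (U V : {vspace L}) : {vspace L} :=
  <<[seq br x y | x <- vbasis U, y <- vbasis V]>>%VS.

Lemma mem_bracket_span (U V : {vspace L}) X Y : X \in U -> Y \in V -> br X Y \in bracket_span U V.
Proof.
move=> XU YV; rewrite (coord_vbasis XU) (coord_vbasis YV).
rewrite (linear_comb _ _ _ (brl _)); apply: memv_suml => i _; apply: memvZ.
rewrite (linear_comb _ _ _ (brr _)); apply: memv_suml => j _; apply: memvZ.
by apply: memv_span; apply: allpairs_f; rewrite mem_nth ?size_tuple.
Qed.

Lemma bracket_span_sub (U V W : {vspace L}) :
  (forall X Y, X \in U -> Y \in V -> br X Y \in W) -> (bracket_span U V <= W)%VS.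
Proof.
move=> h; apply/span_subvP => Z /allpairsP[[X Y] /= [XU YV ->]].
by apply: h; exact: vbasis_mem.
Qed.

End Bracket.

(** * SKT nilpotent Lie algebras are 2-step *)

Section TwoStep.
Variables (R : realType) (L : vectType R) (br : L -> L -> L).
Variables (J : 'End(L)) (g : L -> L -> R) (lc : nat -> {vspace L}) (K : nat).
Hypothesis brl : forall Z, linear (br^~ Z).
Hypothesis brr : forall X, linear (br X).
Hypothesis br_anti : forall X Y, br X Y = - br Y X.
Hypothesis jacobi : forall X Y Z, br X (br Y Z) = br (br X Y) Z + br Y (br X Z).
Hypothesis lc0 : forall X, X \in lc 0.
Hypothesis lcS : forall i X Y, Y \in lc i -> br X Y \in lc i.+1.
Hypothesis lcK : forall X, X \in lc K -> X = 0.
Hypothesis JJ : forall X, J (J X) = - X.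
Hypothesis nij : forall X Y,
  br (J X) (J Y) = br X Y + J (br (J X) Y) + J (br X (J Y)).
Hypothesis hg : bilinear_form g.
Hypothesis sg : forall X Y, g X Y = g Y X.
Hypothesis pg : forall X, X != 0 -> 0 < g X X.
Hypothesis gJ : forall X Y, g (J X) (J Y) = g X Y.

Definition torsion_form P Q S : R :=
  g (br (J P) (J Q)) S + g (br (J Q) (J S)) P + g (br (J S) (J P)) Q.

(* [d c (X, J X, Y, J Y)] for the torsion form [c]. *)
Definition d_torsion_form X Y : R :=
  - torsion_form (br X (J X)) Y (J Y) + torsion_form (br X Y) (J X) (J Y)
  - torsion_form (br X (J Y)) (J X) Y - torsion_form (br (J X) Y) X (J Y)
  + torsion_form (br (J X) (J Y)) X Y - torsion_form (br Y (J Y)) X (J X).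

Hypothesis skt : forall X Y, d_torsion_form X Y = 0.

Let bE := brE brl brr.
Let gE := formE hg.

Lemma JN X : J (- X) = - J X.
Proof. exact: linearN. Qed.

Lemma JD X Y : J (X + Y) = J X + J Y.
Proof. exact: linearD. Qed.

Lemma JZ a X : J (a *: X) = a *: J X.
Proof. exact: linearZ. Qed.

Lemma gJl X Y : g (J X) Y = - g X (J Y).
Proof. by rewrite -gJ JJ gE. Qed.

Lemma g_eq0 X : g X X <= 0 -> X = 0.
Proof. by move=> h; apply/eqP; apply: contraLR h => /pg; rewrite ltNge. Qed.

Lemma g_ge0 X : 0 <= g X X.
Proof. by have [->|/pg/ltW//] := eqVneq X 0; rewrite gE. Qed.

Lemma br_self X : br X X = 0.
Proof.
have /eqP := br_anti X X; rewrite -subr_eq0 opprK -mulr2n -scaler_nat.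
by rewrite scaler_eq0 pnatr_eq0 => /eqP.
Qed.

(** Descending induction along the series: a claim about [lc i] is easy at K, where [lc K] is zero,
    and at 0 it covers the whole algebra. *)
Lemma series_ind (P : nat -> Prop) : P K -> (forall i, P i.+1 -> P i) -> P 0%N.
Proof.
move=> PK PS; suff : forall m, (m <= K)%N -> P (K - m)%N.
  by move=> /(_ K (leqnn _)); rewrite subnn.
elim=> [|m IH] mK; first by rewrite subn0.
by apply: PS; rewrite -subSn // subSS; apply: IH; exact: ltnW.
Qed.

Definition subalgebra (k : {vspace L}) : Prop :=
  (forall X Y, X \in k -> Y \in k -> br X Y \in k) /\
  (forall X, X \in k -> J X \in k).

Definition two_step (k : {vspace L}) : Prop :=
  forall X Y Z, X \in k -> Y \in k -> Z \in k -> br X (br Y Z) = 0.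

(** Put D = ad JX, which commutes with J on k by integrability, and r = [JX, Y]. Both r and [Y, JY]
    lie one term further down the series, so D r = 0 and D [Y, JY] = 0 by induction. Then dc(X, JX,
    Y, JY) = 0 reduces to 2 g(r, r) = 0. *)
Lemma center_complex (k : {vspace L}) X : subalgebra k -> X \in k ->
  (forall Y, Y \in k -> br X Y = 0) -> forall Y, Y \in k -> br (J X) Y = 0.
Proof.
move=> [kb kJ] Xk X0 Y Yk; move: (lc0 Y) => Y0; move: Y Y0 Yk.
apply: (series_ind (P := fun i => forall Y, Y \in lc i -> Y \in k -> br (J X) Y = 0)).
  by move=> Y /lcK -> _; rewrite bE.
move=> i IH Y Yi Yk.
have X0' Z : Z \in k -> br Z X = 0 by move=> Zk; rewrite br_anti X0 ?oppr0.
have DJ Z : Z \in k -> br (J X) (J Z) = J (br (J X) Z).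
  by move=> Zk; rewrite nij X0 // X0 ?kJ // linear0 add0r addr0.
set r := br (J X) Y.
have rk : r \in k by apply: kb => //; exact: kJ.
have Dr : br (J X) r = 0 by apply: IH => //; exact: lcS.
have bk : br Y (J Y) \in k by apply: kb => //; exact: kJ.
have bi : br Y (J Y) \in lc i.+1 by rewrite br_anti memvN lcS.
have Db : br (J X) (br Y (J Y)) = 0 by exact: IH.
have e : br r (J Y) + br Y (J r) = 0 by rewrite -DJ // -jacobi.
have := skt X Y; rewrite /d_torsion_form /torsion_form.
rewrite (X0 _ Yk) (X0 _ (kJ _ Yk)) (X0 _ (kJ _ Xk)).
rewrite !(JJ, linear0, bE, gE).
rewrite (DJ _ Yk) -/r !(JJ, bE, gE) gJ.
rewrite (br_anti (J r)) (DJ _ rk) (br_anti r (J X)) Dr (br_anti (J Y) r).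
rewrite (br_anti (J (br _ _))) (DJ _ bk) Db (br_anti (J X) X) (X0 _ (kJ _ Xk)).
rewrite (X0 _ (kJ _ bk)) !linear0 !gE.
have := congr1 (fun Z => g Z X) e; rewrite !gE => e'.
by move=> E; apply: g_eq0; lra.
Qed.

(* If [lc i + J lc i] is everything, integrability puts every bracket into
   [lc i.+1 + J lc i.+1]. *)
Lemma commutator_complex_proper (k : {vspace L}) : subalgebra k -> k != 0%VS ->
  (forall W : {vspace L}, (forall X Y, X \in k -> Y \in k -> br X Y \in W) ->
     (forall X, X \in W -> J X \in W) -> (k <= W)%VS) -> False.
Proof.
move=> [kb kJ] k0 hW.
(* Every element of k is A + JB with A and B in k and in [lc i], for each i; at i = K this gives k =
   0. *)
suff h i X : X \in k -> exists A B, [/\ A \in lc i, A \in k, B \in lc i, B \in k & X = A + J B].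
  case/eqP: k0; apply/eqP; rewrite -subv0; apply/subvP => X /(h K).
  by move=> [A [B [/lcK -> _ /lcK -> _ ->]]]; rewrite linear0 addr0 mem0v.
elim: i X => [|i IH].
  by move=> X Xk; exists X, 0; rewrite !lc0 Xk mem0v linear0 addr0.
pose P X := exists A B,
  [/\ A \in lc i.+1, A \in k, B \in lc i.+1, B \in k & X = A + J B].
have PD a X Y : P X -> P Y -> P (a *: X + Y).
  move=> [A [B [A1 A2 B1 B2 ->]]] [A' [B' [A1' A2' B1' B2' ->]]].
  exists (a *: A + A'), (a *: B + B').
  by rewrite !rpredD ?rpredZ // linearP scalerDr addrACA.
have PD' X Y : P X -> P Y -> P (X + Y) by move=> /(PD 1) h /h; rewrite scale1r.
have P0 : P 0 by exists 0, 0; rewrite !mem0v linear0 addr0.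
have Pi X : X \in lc i.+1 -> X \in k -> P X.
  by move=> X1 X2; exists X, 0; rewrite !mem0v linear0 addr0.
have PJ X : P X -> P (J X).
  move=> [A [B [A1 A2 B1 B2 ->]]]; exists (- B), A.
  by rewrite !rpredN linearD /= JJ addrC.
have [W WP] := vspace_of_pred P0 PD.
move=> X Xk; apply/WP; apply: (subvP (hW W _ _)) Xk; last first.
  by move=> {}X /WP XW; apply/WP; exact: PJ.
move=> {}X Y /IH[A [B [A1 A2 B1 B2 ->]]] /IH[A' [B' [A1' A2' B1' B2' ->]]].
apply/WP; rewrite !bE nij.
have ri U V : V \in lc i -> U \in k -> V \in k -> P (br U V).
  by move=> Vi Uk Vk; apply: Pi; [exact: lcS|exact: kb].
have li U V : V \in lc i -> U \in k -> V \in k -> P (br V U).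
  move=> Vi Uk Vk; rewrite br_anti; apply: Pi; first by rewrite memvN lcS.
  by rewrite memvN kb.
have pAA := ri A A' A1' A2 A2'; have pJA := ri (J B) A' A1' (kJ _ B2) A2'.
have pAJ := li (J B') A A1 (kJ _ B2') A2; have pBB := ri B B' B1' B2 B2'.
have pJB := PJ _ (ri (J B) B' B1' (kJ _ B2) B2').
have pBJ := PJ _ (li (J B') B B1 (kJ _ B2') B2).
clearbody P; by repeat first [assumption | apply: (PD')].
Qed.

(* Sums over an orthonormal basis of an ideal turn this identity into
   [skew_pair_vanish]. *)
Lemma pair_defect_skt X A :
  let b := br A (J A) in let a := br X (J X) in
  pair_defect g J (br A) (br (J A)) X =
    2 * g a b + g (br (J b) (J X)) (J X) + g (br (J b) X) X
    - g (br (J (br A X)) X) (J A) + g (br (J (br (J A) X)) X) A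
    - g (br (J (br A (J X))) (J X)) (J A) + g (br (J (br (J A) (J X))) (J X)) A
    - g (br (J A) (J a)) (J A) - g (br A (J a)) A.
Proof.
move=> b a; have := skt X A; rewrite /d_torsion_form /torsion_form.
rewrite /pair_defect -/a -/b.
have bA : br (J A) A = - b by exact: br_anti.
have aX : br (J X) X = - a by exact: br_anti.
clearbody a b; rewrite (br_anti X A) (br_anti X (J A)) (br_anti (J X) A).
rewrite (br_anti (J X) (J A)) !(JJ, bE, gE, JN) bA aX.
rewrite (br_anti X A) (br_anti X (J A)) (br_anti (J X) A) (br_anti (J a)).
by rewrite (br_anti X (J b)) !gE (sg b a) => E; lra.
Qed.

(** In a 2-step k brackets are central, and so are their images under J by [center_complex]. Only
    the terms of dc(X, JX, Y, JY) that pair two brackets survive. *)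
Lemma two_step_skt (k : {vspace L}) X Y : subalgebra k -> two_step k ->
  X \in k -> Y \in k ->
  2 * g (br X (J X)) (br Y (J Y)) =
    g (br X Y) (br X Y) + g (br X (J Y)) (br X (J Y))
    + g (br (J X) Y) (br (J X) Y) + g (br (J X) (J Y)) (br (J X) (J Y)).
Proof.
move=> kk k2 Xk Yk; have [kb kJ] := kk.
have Xk' := kJ _ Xk; have Yk' := kJ _ Yk.
have z1 U V W : U \in k -> V \in k -> W \in k -> br (J (br U V)) W = 0.
  move=> Uk Vk Wk; apply: (center_complex _ (k := k)) => //; first exact: kb.
  by move=> T Tk; rewrite br_anti k2 ?oppr0.
have z2 U V W : U \in k -> V \in k -> W \in k -> br W (J (br U V)) = 0.
  by move=> Uk Vk Wk; rewrite br_anti z1 ?oppr0.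
have := skt X Y; rewrite /d_torsion_form /torsion_form.
rewrite !JJ !(bE, gE, JN) !z1 // !z2 // !gE.
by rewrite (br_anti (J X) X) (br_anti (J Y) Y) !gE (sg (br Y _)) => E; lra.
Qed.

(** A closed form that tames J modulo a J-invariant central Z forces k / Z to be abelian. First, the
    elements X of k with [X, k] in Z are stable under J. Then, for W = [X, Y], descending induction
    puts [W, k] and hence [JW, k] in Z, and closedness on X, Y, JW leaves Om(W, JW) = 0. *)
Lemma tamed_commutator (k : {vspace L}) (Z : L -> Prop) (Om : L -> L -> R) :
  subalgebra k -> Z 0 -> (forall a X Y, Z X -> Z Y -> Z (a *: X + Y)) ->
  (forall X, Z X -> Z (J X)) ->
  (forall X Y, Z X -> Y \in k -> br X Y = 0) ->
  bilinear_form Om -> (forall X Y, Om X Y = - Om Y X) ->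
  (forall X Y W, Om (br X Y) W + Om (br Y W) X + Om (br W X) Y = 0) ->
  (forall X Y, Z X -> Y \in k -> Om X Y = 0) ->
  (forall X, X \in k -> Om X (J X) = 0 -> Z X) ->
  forall X Y, X \in k -> Y \in k -> Z (br X Y).
Proof.
move=> [kb kJ] Z0 ZD ZJ Zc hO aO cO ZO OZ.
have OE := formE hO.
have ZD' X Y : Z X -> Z Y -> Z (X + Y).
  by move=> /(ZD 1) h /h; rewrite scale1r.
have ZN X : Z X -> Z (- X).
  by move=> /(ZD (- 1)) /(_ Z0); rewrite addr0 scaleN1r.
have Zbr X Y : Z (br X Y) -> Z (br Y X) by rewrite br_anti => /ZN; rewrite opprK.
have stab X : X \in k -> (forall Y, Y \in k -> Z (br X Y)) ->
    forall Y, Y \in k -> Z (br (J X) Y).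
  move=> Xk XZ Y Yk; move: (lc0 Y) => Y0; move: Y Y0 Yk.
  pose P i := forall Y, Y \in lc i -> Y \in k -> Z (br (J X) Y).
  apply: (series_ind (P := P)); first by move=> Y /lcK -> _; rewrite bE.
  move=> i IH Y Yi Yk; have Xk' := kJ _ Xk; have Yk' := kJ _ Yk.
  have DJ V : V \in k -> exists2 z, Z z & br (J X) (J V) = J (br (J X) V) + z.
    move=> Vk; exists (br X V + J (br X (J V))).
      by apply: ZD'; [exact: XZ | apply: ZJ; apply: XZ; exact: kJ].
    by rewrite nij addrA (addrC (J _)).
  set r := br (J X) Y; have rk : r \in k by exact: kb.
  have rk' := kJ _ rk.
  have Dr : Z (br (J X) r) by apply: IH => //; exact: lcS.
  have DJr : Z (br (J X) (J r)).
    by have [z Zz ->] := DJ _ rk; apply: ZD' => //; exact: ZJ.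
  have [z Zz Ez] := DJ _ Yk; rewrite -/r in Ez.
  have Db : Z (br (J X) (br Y (J Y))).
    by apply: IH; [rewrite br_anti memvN lcS | exact: kb].
  have e1 : br Y (J r) = br (J X) (br Y (J Y)) - br r (J Y).
    have zY : br Y z = 0 by rewrite br_anti Zc ?oppr0.
    by rewrite jacobi -/r addrC addKr Ez bE zY addr0.
  apply: OZ => //.
  (* With r = [JX, Y], the two instances of closedness add up to 2 Om(r, Jr) = 0: the terms
     Om([r, JY], JX) cancel and the others vanish by the induction hypothesis. *)
  have h1 := cO (J X) Y (J r); have h2 := cO r (J Y) (J X).
  have e2 : Om (br (J r) (J X)) Y = 0 by apply: ZO => //; exact: Zbr.
  have e3 : Om (br (J X) (br Y (J Y))) (J X) = 0 by exact: ZO.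
  have e4 : Om (br (J X) r) (J Y) = 0 by exact: ZO.
  have e5 : Om (br (J Y) (J X)) r = Om r (J r).
    by rewrite br_anti Ez !OE (ZO z) // addr0 -aO.
  rewrite -/r e1 !OE e2 e3 in h1; rewrite e4 e5 in h2; lra.
move=> X Y Xk Yk; move: (lc0 Y) => Y0; move: X Y Y0 Xk Yk.
pose P i := forall X Y, Y \in lc i -> X \in k -> Y \in k -> Z (br X Y).
apply: (series_ind (P := P)); first by move=> X Y /lcK ->; rewrite bE.
move=> i IH X Y Yi Xk Yk; set W := br X Y; have Wk : W \in k by exact: kb.
have WZ V : V \in k -> Z (br W V).
  by move=> Vk; apply: Zbr; apply: IH => //; exact: lcS.
have JWZ := stab _ Wk WZ.
apply: OZ => //; have := cO X Y (J W).
by rewrite (ZO (br Y _)) ?(ZO (br (J W) _)) ?addr0 //; [exact: JWZ | apply: Zbr; exact: JWZ].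
Qed.

Lemma iter_br_series A n X : iter n (br A) X \in lc n.
Proof. by elim: n => [|n IH] /=; [exact: lc0 | exact: lcS]. Qed.

(** The trace inequality for ad A and ad JA on the center z of h. Since z is a J-invariant ideal of
    k, each term on the right of [pair_defect_skt] contains a bracket of z with h and vanishes. *)
Lemma br_center_vanish (k h z : {vspace L}) A : subalgebra k -> subalgebra h ->
  (h <= k)%VS -> (forall X Y, X \in k -> Y \in k -> br X Y \in h) ->
  (forall X, X \in z <-> X \in h /\ forall Y, Y \in h -> br X Y = 0) ->
  A \in k -> forall X, X \in z -> br A X = 0 /\ br (J A) X = 0.
Proof.
move=> [kb kJ] [hb hJ] /subvP hk kh zP Ak.
have Ak' := kJ _ Ak.
have zh X : X \in z -> X \in h by move=> /zP[].
have zJ X : X \in z -> J X \in z.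
  move=> /zP[Xh X0]; apply/zP; split; first exact: hJ.
  by apply: (center_complex (k := h)).
have z0 X Y : X \in z -> Y \in h -> br X Y = 0 by move=> /zP[_]; apply.
have z0' X Y : X \in z -> Y \in h -> br Y X = 0.
  by move=> Xz Yh; rewrite br_anti z0 ?oppr0.
have zN B X : B \in k -> X \in z -> br B X \in z.
  move=> Bk Xz; apply/zP; split; first by apply: kh => //; apply/hk/zh.
  move=> Y Yh; have := jacobi B X Y; rewrite (z0 _ _ Xz Yh) (z0 X (br B Y)) //.
    by rewrite bE addr0.
  by apply: kh => //; exact: hk.
have pz X : X \in z -> X != 0 -> 0 < g X X by move=> _; exact: pg.
have [e he] := onb_exists hg sg pz; have [ez _ _] := he.
apply: (@pair_vanish _ _ g J hg sg JJ gJ z _ e he _ _ (brr A) (brr (J A)) K) => //.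
- by move=> X Xz; exact: zN.
- by move=> X Xz; exact: zN.
- by move=> X Xz; rewrite nij -(addrA (br A X)) addrAC subrr add0r.
- by move=> X Xz; apply: lcK; exact: iter_br_series.
- by move=> X Xz; apply: lcK; exact: iter_br_series.
- move=> T X Xz; rewrite /T.
  have cE Y : br A (br (J A) Y) - br (J A) (br A Y) = br (br A (J A)) Y.
    by rewrite jacobi addrK.
  by rewrite !cE (z0' X) ?kh // linear0 bE linear0.
- rewrite big1 // => i _; rewrite pair_defect_skt.
  have eJz := zJ _ (ez i); have eh := zh _ eJz.
  rewrite (z0 (e i) (J (e i))) // linear0 !bE.
  have bh : J (br A (J A)) \in h by apply: hJ; exact: kh.
  rewrite (z0' (e i)) // (z0' (J (e i))) //.
  have N0 B Y : B \in k -> Y \in z -> br (J (br B Y)) Y = 0.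
    by move=> Bk Yz; rewrite z0 //; [apply: zJ; exact: zN|exact: zh].
  by rewrite !N0 // !gE !(mulr0, addr0, subr0).
Qed.

(** The trace inequality for ad A and ad JA on h itself. Brackets of h are central in h, hence
    orthogonal to A and JA and killed, with their J-images, by both operators. The sum of
    [pair_defect_skt] then reduces to 2 g(S, [A, JA]), with S the sum of the [e, Je]. *)
Lemma br_two_step_vanish (k h : {vspace L}) A d (e : 'I_d -> L) :
  subalgebra k -> subalgebra h -> two_step h ->
  (h <= k)%VS -> (forall X Y, X \in k -> Y \in k -> br X Y \in h) ->
  A \in k ->
  (forall X, X \in h -> (forall Y, Y \in h -> br X Y = 0) ->
     [/\ br A X = 0, br (J A) X = 0, g X A = 0 & g X (J A) = 0]) ->
  onb g h e -> g (\sum_i br (e i) (J (e i))) (br A (J A)) <= 0 ->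
  forall X, X \in h -> br A X = 0 /\ br (J A) X = 0.
Proof.
move=> [kb kJ] hh h2 /subvP hk kh Ak Az he le; have [hb hJ] := hh.
have [eh _ _] := he.
have bh : br A (J A) \in h by apply: kh => //; exact: kJ.
have z2 X Y Z : X \in h -> Y \in h -> Z \in h -> br (br X Y) Z = 0.
  by move=> Xh Yh Zh; rewrite br_anti h2 ?oppr0.
have z2J X Y Z : X \in h -> Y \in h -> Z \in h -> br (J (br X Y)) Z = 0.
  move=> Xh Yh Zh; apply: (center_complex (k := h)) => //; first exact: hb.
  by move=> T Th; exact: z2.
have Ab X Y : X \in h -> Y \in h ->
    [/\ br A (br X Y) = 0, br (J A) (br X Y) = 0, g (br X Y) A = 0 & g (br X Y) (J A) = 0].
  by move=> Xh Yh; apply: Az; [exact: hb | move=> Z Zh; exact: z2].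
have AJb X Y : X \in h -> Y \in h -> br A (J (br X Y)) = 0 /\ br (J A) (J (br X Y)) = 0.
  move=> Xh Yh; have [||-> ->] := Az (J (br X Y)) => //.
    by apply: hJ; exact: hb.
  by move=> Z Zh; exact: z2J.
have hN B X : B \in k -> X \in h -> br B X \in h.
  by move=> Bk Xh; apply: kh => //; exact: hk.
have Ak' := kJ _ Ak.
apply: (@pair_vanish _ _ g J hg sg JJ gJ h _ e he _ _ (brr A) (brr (J A)) K) => //.
- by move=> X Xh; exact: hN.
- by move=> X Xh; exact: hN.
- by move=> X Xh; rewrite nij -(addrA (br A X)) addrAC subrr add0r.
- by move=> X Xh; apply: lcK; exact: iter_br_series.
- by move=> X Xh; apply: lcK; exact: iter_br_series.
- move=> T X Xh; rewrite /T.
  have cE Y : br A (br (J A) Y) - br (J A) (br A Y) = br (br A (J A)) Y.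
    by rewrite jacobi addrK.
  by rewrite !cE (br_anti _ (J _)) z2J // oppr0 linear0.
(* For B in h, ad B is nilpotent on h and so is its conjugate by J, so both have trace 0. This
   removes the terms containing J [A, JA]. *)
- have t0 B : B \in h -> \sum_i g (br B (e i)) (e i) = 0 /\
      \sum_i g (br B (J (e i))) (J (e i)) = 0.
    move=> Bh; split.
      rewrite -(trace_coord_mx g e (br B)); apply: (trace_nilpotent hg he (k := 2)) => //.
      + by move=> X Xh; exact: hb.
      + by move=> X Xh /=; exact: h2.
    under eq_bigr => i _ do rewrite sg gJl sg.
    rewrite sumrN -(trace_coord_mx g e (fun X => J (br B (J X)))).
    rewrite (trace_nilpotent hg he (k := 2)) ?oppr0 //.
    + by move=> a X Y; rewrite !(linearP, brr).
    + by move=> X Xh; do 2?apply: (hJ); apply: hb => //; exact: hJ.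
    + by move=> X Xh /=; rewrite JJ !bE h2 ?oppr0 ?linear0 // hJ.
  have [t1 t2] := t0 _ (hJ _ bh).
  rewrite (eq_bigr (fun i => 2 * g (br (e i) (J (e i))) (br A (J A))
      + g (br (J (br A (J A))) (J (e i))) (J (e i))
      + g (br (J (br A (J A))) (e i)) (e i))).
    rewrite !big_split /= t1 t2 !addr0 -mulr_sumr -form_suml //; lra.
  move=> i _; rewrite pair_defect_skt.
  have Jh := hJ _ (eh i).
  have [-> ->] := AJb _ _ (eh i) Jh.
  have Nh B Y : B \in k -> Y \in h -> J (br B Y) \in h.
    by move=> Bk Yh; apply: hJ; exact: hN.
  have [_ _ _ ->] := Ab _ _ (Nh A _ Ak (eh i)) (eh i).
  have [_ _ -> _] := Ab _ _ (Nh (J A) _ Ak' (eh i)) (eh i).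
  have [_ _ _ ->] := Ab _ _ (Nh A _ Ak Jh) Jh.
  have [_ _ -> _] := Ab _ _ (Nh (J A) _ Ak' Jh) Jh.
  by rewrite !gE !(addr0, subr0).
Qed.

Definition complex_line_sum (k h : {vspace L}) A : Prop :=
  forall X, X \in k -> exists Y a b, Y \in h /\ X = Y + a *: A + b *: J A.

(** If A and JA commute with h, every bracket of k is a bracket of h plus a multiple of [A, JA], and
    [A, JA] commutes with h by the Jacobi identity. *)
Lemma two_step_extension (k h : {vspace L}) A : subalgebra h -> two_step h ->
  (forall X Y, X \in k -> Y \in k -> br X Y \in h) -> A \in k -> J A \in k ->
  complex_line_sum k h A ->
  (forall X, X \in h -> br A X = 0 /\ br (J A) X = 0) -> two_step k.
Proof.
move=> [hb hJ] h2 kh Ak Ak' dec A0.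
have bh : br A (J A) \in h by exact: kh.
have A1 X : X \in h -> br A X = 0 by move=> /A0[].
have A2 X : X \in h -> br (J A) X = 0 by move=> /A0[].
have A1' X : X \in h -> br X A = 0 by move=> /A1; rewrite (br_anti X) => ->; rewrite oppr0.
have A2' X : X \in h -> br X (J A) = 0 by move=> /A2; rewrite (br_anti X) => ->; rewrite oppr0.
have c X : X \in h -> br X (br A (J A)) = 0.
  by move=> Xh; rewrite jacobi (A1' _ Xh) (A2' _ Xh) !bE addr0.
move=> X Y Z Xk Yk Zk.
have Wh : br Y Z \in h by exact: kh.
have [X' [a [b [X'h ->]]]] := dec _ Xk.
rewrite !bE (A1 _ Wh) (A2 _ Wh) !scaler0 !addr0.
have [Y' [a1 [b1 [Y'h ->]]]] := dec _ Yk.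
have [Z' [a2 [b2 [Z'h ->]]]] := dec _ Zk.
rewrite !bE (br_self A) (br_self (J A)) (br_anti (J A) A).
rewrite (A1 _ Z'h) (A2 _ Z'h) (A1' _ Y'h) (A2' _ Y'h) !bE (c _ X'h) h2 //.
by rewrite !(bE, scaler0, addr0, add0r, oppr0).
Qed.

Theorem nilpotent_skt_two_step (k : {vspace L}) : subalgebra k -> two_step k.
Proof.
have [n] := ubnP (\dim k); elim: n k => // n IH k kn kk; have [kb kJ] := kk.
have [->|k0] := eqVneq k 0%VS.
  by move=> X Y Z; rewrite memv0 => /eqP ->; rewrite bE.
(* p is [k, k] + J [k, k]. It is proper in k by [commutator_complex_proper], so subtracting from an
   element of k outside p its projection to p gives A. *)
have [p [pJ pb [A [Ak A0 Ap]]]] : exists p : {vspace L},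
    [/\ forall X, X \in p -> J X \in p,
        forall X Y, X \in k -> Y \in k -> br X Y \in p &
        exists A, [/\ A \in k, A != 0 & forall X, X \in p -> g A X = 0]].
  pose d := bracket_span br k k; pose p := (d + J @: d)%VS.
  have pJ X : X \in p -> J X \in p.
    move=> /memv_addP[U Ud [V /memv_imgP[W Wd ->] ->]].
    rewrite linearD /= JJ addrC; apply: memv_add; first by rewrite memvN.
    exact: memv_img.
  have pb X Y : X \in k -> Y \in k -> br X Y \in p.
    move=> Xk Yk; apply: (subvP (addvSl d (J @: d))).
    exact: mem_bracket_span.
  exists p; split=> //.
  have pos X : X \in p -> X != 0 -> 0 < g X X by move=> _; exact: pg.
  have [kp|/subvPn[X Xk Xp]] := boolP (k <= p)%VS.
    exfalso; apply: (commutator_complex_proper kk k0) => W Wb WJ.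
    apply: subv_trans kp _; have dW : (d <= W)%VS by exact: bracket_span_sub.
    rewrite subv_add dW; apply/subvP => X /memv_imgP[U Ud ->].
    by apply: WJ; exact: subvP dW _ Ud.
  have [Y Yp XY] := orthogonal_projection X hg sg pos.
  exists (X - Y); split=> //.
    apply: memvB => //.
    suff /subvP : (p <= k)%VS by apply.
    have dk : (d <= k)%VS by exact: bracket_span_sub.
    rewrite subv_add dk; apply/subvP => _ /memv_imgP[U Ud ->].
    by apply: kJ; exact: subvP dk _ Ud.
  by apply: contra Xp; rewrite subr_eq0 => /eqP ->.
have Ak' := kJ _ Ak; have gA := pg A0.
have gAJ : g A (J A) = 0 by have := gJl A A; rewrite (sg (J A)) => ?; lra.
(* h is the orthogonal complement of A and JA in k. It is J-invariant, contains p and hence [k, k],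
   and misses A, so the induction hypothesis applies to it. *)
have [h hP] : exists h : {vspace L}, forall X, X \in h <->
    [/\ X \in k, g X A = 0 & g X (J A) = 0].
  apply: vspace_of_pred; first by rewrite mem0v !gE.
  move=> a X Y [Xk X1 X2] [Yk Y1 Y2].
  by rewrite memvD ?memvZ // !gE X1 X2 Y1 Y2 !mulr0 addr0.
have hkP X : X \in h -> X \in k by move=> /hP[].
have hk : (h <= k)%VS by apply/subvP.
have kh X Y : X \in k -> Y \in k -> br X Y \in h.
  move=> Xk Yk; apply/hP; split; first exact: kb.
    by rewrite sg Ap ?pb.
  by rewrite -gJ JJ gE sg Ap ?oppr0 // pJ ?pb.
have hh : subalgebra h.
  split=> [X Y /hkP Xk /hkP Yk|X /hP[Xk X1 X2]]; first exact: kh.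
  by apply/hP; rewrite kJ // gJl X2 gJ X1 oppr0.
have h2 : two_step h.
  apply: IH => //; rewrite ltnS in kn; apply: leq_trans kn.
  rewrite ltn_neqAle dimvS // andbT; apply/negP => /eqP hd.
  have /eqP hE : h == k by rewrite eqEdim hk hd /=.
  have : A \in h by rewrite hE.
  by move=> /hP[_ gA0 _]; rewrite gA0 ltxx in gA.
have dec : complex_line_sum k h A.
  move=> X Xk; exists (X - (g X A / g A A) *: A - (g X (J A) / g A A) *: J A).
  exists (g X A / g A A), (g X (J A) / g A A); split; last first.
    by rewrite addrAC !subrK.
  apply/hP; rewrite !memvB ?memvZ // !gE gJ (sg (J A)) gAJ !mulr0 subr0.
  by rewrite subr0 !divfK ?gt_eqF // !subrr.
have [hb hJ] := hh.
have [z zP] : exists z : {vspace L}, forall X, X \in z <->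
    X \in h /\ forall Y, Y \in h -> br X Y = 0.
  apply: vspace_of_pred; first by split=> [|Y _]; rewrite ?mem0v ?bE.
  move=> a X Y [Xh X0] [Yh Y0]; split; first by rewrite memvD ?memvZ.
  by move=> Z Zh; rewrite !bE X0 // Y0 // scaler0 addr0.
have zA := br_center_vanish kk hh hk kh zP Ak.
have zh X : X \in z -> X \in h by move=> /zP[].
have zJ X : X \in z -> J X \in z.
  move=> /zP[Xh X0]; apply/zP; split; first exact: hJ.
  exact: (center_complex (k := h)).
have zk X Y : X \in z -> Y \in k -> br X Y = 0.
  move=> Xz /dec[Y' [a [b [Y'h ->]]]]; have [/(_ Xz)[_ X0] _] := zP X.
  rewrite !bE X0 // (br_anti _ A) (br_anti _ (J A)).
  by have [-> ->] := zA _ Xz; rewrite oppr0 !scaler0 !addr0.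
have ph X : X \in h -> X != 0 -> 0 < g X X by move=> _; exact: pg.
have [e he] := onb_exists hg sg ph; have [eh _ _] := he.
pose S := \sum_i br (e i) (J (e i)).
pose Om X Y := g (br X Y) S.
have OmB : bilinear_form Om.
  by split=> [X|Y] a U V; rewrite /Om !(bE, gE).
have OmA X Y : Om X Y = - Om Y X by rewrite /Om br_anti gE.
have OmC X Y W : Om (br X Y) W + Om (br Y W) X + Om (br W X) Y = 0.
  rewrite /Om (br_anti (br Y W)) (jacobi X Y W) (br_anti (br W X)).
  by rewrite (br_anti W X) !(bE, gE); ring.
have OmZ X Y : X \in z -> Y \in k -> Om X Y = 0.
  by move=> Xz Yk; rewrite /Om zk // gE.
have Omh X : X \in h -> 0 <= Om X (J X).
  move=> Xh; rewrite /Om form_sumr //; apply: sumr_ge0 => i _.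
  have := two_step_skt hh h2 Xh (eh i).
  have := g_ge0 (br X (e i)); have := g_ge0 (br X (J (e i))).
  by have := g_ge0 (br (J X) (e i)); have := g_ge0 (br (J X) (J (e i))); lra.
(* Each summand of Om(X, JX) is at least half the squared norm of [X, e_i], so a nonpositive sum
   makes X commute with the whole basis. *)
have Omz X : X \in h -> Om X (J X) <= 0 -> X \in z.
  move=> Xh le; apply/zP; split=> // Y Yh.
  suff ei i : br X (e i) = 0.
    have [_ _ eX] := he; rewrite (eX _ Yh) (linear_comb _ _ _ (brr X)).
    by rewrite big1 // => i _; rewrite ei scaler0.
  apply: g_eq0.
  have pos j : 0 <= g (br X (J X)) (br (e j) (J (e j))) - 2^-1 * g (br X (e j)) (br X (e j)).
    have := two_step_skt hh h2 Xh (eh j).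
    have := g_ge0 (br X (J (e j))); have := g_ge0 (br (J X) (e j)).
    by have := g_ge0 (br (J X) (J (e j))); lra.
  have : 2^-1 * g (br X (e i)) (br X (e i)) <= Om X (J X); last by lra.
  rewrite /Om form_sumr // -subr_ge0 (bigD1 i) //= addrAC addr_ge0 //.
  apply: sumr_ge0 => j _; have := pos j; have := g_ge0 (br X (e j)); lra.
(* The symmetrisation of Om(X, JY) is definite on h only modulo z, so A is projected to the
   g-complement w of z in h. As Y0 is then g-orthogonal to z, so are B = A - Y0 and JB, which
   [br_two_step_vanish] requires. *)
pose bb X Y := 2^-1 * (Om X (J Y) + Om Y (J X)).
have OE := formE OmB.
have bbB : bilinear_form bb.
  by split=> [X|Y] a U V; rewrite /bb !linearP !OE; ring.
have bbS X Y : bb X Y = bb Y X by rewrite /bb addrC.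
have bbX X : bb X X = Om X (J X) by rewrite /bb; lra.
have bE' := formE bbB.
have [w wP] : exists w : {vspace L}, forall X, X \in w <->
    X \in h /\ forall Y, Y \in z -> g X Y = 0.
  apply: vspace_of_pred; first by split=> [|Y _]; rewrite ?mem0v ?gE.
  move=> a X Y [Xh X0] [Yh Y0]; split; first by rewrite memvD ?memvZ.
  by move=> Z Zh; rewrite !gE X0 // Y0 // mulr0 addr0.
have wpos X : X \in w -> X != 0 -> 0 < bb X X.
  move=> /wP[Xh X0] Xn0; rewrite ltNge bbX; apply/negP => /(Omz _ Xh) Xz.
  by move: (pg Xn0); rewrite X0 // ltxx.
have [Y0 Y0w AY] := orthogonal_projection A bbB bbS wpos.
have /wP[Y0h Y0z] := Y0w.
pose B := A - Y0.
have Bk : B \in k by apply: memvB => //; exact: hkP.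
have Bk' := kJ _ Bk.
have decB : complex_line_sum k h B.
  move=> X /dec[Y [a [b [Yh ->]]]].
  exists (Y + a *: Y0 + b *: J Y0), a, b; split.
    by rewrite !memvD // memvZ // hJ.
  rewrite /B (linearB J) /= !scalerBr (addrAC (Y + _) (b *: J Y0)).
  rewrite -(addrA _ (b *: J Y0)) (addrC (b *: J Y0)) subrK.
  by rewrite -(addrA Y (a *: Y0)) (addrC (a *: Y0)) subrK.
have bbh X : X \in h -> bb B X = 0.
  move=> Xh; have pz V : V \in z -> V != 0 -> 0 < g V V by move=> _; exact: pg.
  have [V Vz XV] := orthogonal_projection X hg sg pz.
  have XVw : X - V \in w by apply/wP; rewrite memvB // zh.
  rewrite -(subrK V X) formDr // AY // add0r /bb (OmZ V) // OmA (OmZ (J V)) //.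
    by rewrite oppr0 addr0 mulr0.
  exact: zJ.
have zAB X : X \in h -> (forall Y, Y \in h -> br X Y = 0) ->
     [/\ br B X = 0, br (J B) X = 0, g X B = 0 & g X (J B) = 0].
  move=> Xh X0; have Xz : X \in z by apply/zP.
  have /hP[_ gX1 gX2] := Xh.
  rewrite !(br_anti _ X) !zk // oppr0 /B linearB /= !gE gX1 gX2 (sg X Y0) Y0z //.
  by rewrite -gJ JJ gE (sg _ Y0) (Y0z _ (zJ _ Xz)) !oppr0 addr0.
clearbody B.
have [le|lt] := leP (Om B (J B)) 0.
  apply: (two_step_extension hh h2 kh Bk Bk' decB).
  apply: (br_two_step_vanish kk hh h2 hk kh Bk zAB he).
  by rewrite sg.
have comm : forall X Y, X \in k -> Y \in k -> br X Y \in z.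
  apply: (tamed_commutator (Z := fun X => X \in z) (Om := Om)) => //.
  - exact: mem0v.
  - by move=> a X Y Xz Yz; rewrite memvD ?memvZ.
  move=> X /decB[Y [a [b [Yh ->]]]].
  (* The cross terms are values bb(B, .) on h and vanish. What remains, Om(Y, JY) + (a^2 + b^2)
     Om(B, JB), has nonnegative summands, so it vanishes only if a = b = 0 and Y is in z. *)
  have -> : Om (Y + a *: B + b *: J B) (J (Y + a *: B + b *: J B)) =
      Om Y (J Y) + (a ^+ 2 + b ^+ 2) * Om B (J B)
      + 2 * a * bb B Y - 2 * b * bb B (J Y).
    have O0 V : Om V V = 0 by rewrite /Om br_self gE.
    have JE : J (Y + a *: B + b *: J B) = J Y + a *: J B - b *: B.
      by rewrite !JD !JZ JJ scalerN.
    rewrite /bb JE JJ !OE (OmA (J B) (J Y)) (OmA (J B) B) (OmA Y B) !O0.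
    by field.
  rewrite bbh // bbh ?hJ // !mulr0 subr0 addr0 => E.
  have Yz : Y \in z by apply: Omz => //; nra.
  have ab : a ^+ 2 + b ^+ 2 = 0.
    have := Omh _ Yh => ?; apply/eqP; rewrite eq_le; apply/andP; split; nra.
  have a0 : a = 0 by nra.
  have b0 : b = 0 by nra.
  by rewrite a0 b0 !scale0r !addr0.
by move=> X Y Z Xk Yk Zk; rewrite br_anti zk ?oppr0 // comm.
Qed.

End TwoStep.

(** * The Bismut connection *)

Section Bismut.
Variables (R : realType) (L : vectType R) (br : L -> L -> L).
Variables (J : 'End(L)) (g : L -> L -> R).
Hypothesis brl : forall Z, linear (br^~ Z).
Hypothesis brr : forall X, linear (br X).
Hypothesis br_anti : forall X Y, br X Y = - br Y X.
Hypothesis JJ : forall X, J (J X) = - X.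
Hypothesis nij : forall X Y,
  br (J X) (J Y) = br X Y + J (br (J X) Y) + J (br X (J Y)).
Hypothesis hg : bilinear_form g.
Hypothesis sg : forall X Y, g X Y = g Y X.
Hypothesis pg : forall X, X != 0 -> 0 < g X X.
Hypothesis gJ : forall X Y, g (J X) (J Y) = g X Y.
Variables (d : nat) (f : 'I_d -> L).
Hypothesis hf : onb g {:L}%VS f.

Let bE := brE brl brr.
Let gE := formE hg.
Let c := torsion_form br J g.

(** A is skew and commutes with J, so JA is symmetric, and the pairing of a skew with a symmetric
    operator is 0. *)
Lemma trace_commutator n (e : 'I_n -> L) (A B : L -> L) : onb g {:L}%VS e ->
  (forall X Y, g (A X) Y = - g X (A Y)) -> (forall X Y, g (B X) Y = - g X (B Y)) ->
  (forall X, A (J X) = J (A X)) -> \sum_i g (B (e i)) (J (A (e i))) = 0.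
Proof.
move=> he Aa Ba AJ.
have gJr U V : g U (J V) = - g (J U) V by rewrite -gJ JJ gE.
pose s := \sum_i \sum_j g (B (e i)) (e j) * g (J (A (e i))) (e j).
have E : \sum_i g (B (e i)) (J (A (e i))) = s.
  by apply: eq_bigr => i _; rewrite (onb_parseval hg he (memvf _) (memvf _) sg).
rewrite E; suff : s = - s by lra.
rewrite /s -sumrN exchange_big /=; apply: eq_bigr => i _.
rewrite -sumrN; apply: eq_bigr => j _.
rewrite Ba mulNr (sg (e j)); congr (- (_ * _)).
by rewrite -[LHS]opprK -gJr Aa opprK AJ sg.
Qed.

(** The Koszul formula of the Levi-Civita connection on left-invariant fields, minus half of c; the
    torsion 3-form of the resulting connection is - c. *)
Definition bismut_form X Y Z : R :=
  2^-1 * (g (br X Y) Z - g (br Y Z) X + g (br Z X) Y - c X Y Z).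

Definition bismut X Y : L := \sum_i bismut_form X Y (f i) *: f i.

Let bJD X Y : J (X + Y) = J X + J Y. Proof. exact: linearD. Qed.
Let bJZ a X : J (a *: X) = a *: J X. Proof. exact: linearZ. Qed.
Let bJN X : J (- X) = - J X. Proof. exact: linearN. Qed.
Let JE := (bJD, bJZ, bJN).

Lemma nondegenerate X Y : (forall Z, g X Z = g Y Z) -> X = Y.
Proof.
move=> h; apply/eqP; rewrite -subr_eq0; apply/negPn/negP => /pg.
by rewrite formDl // formNl // h subrr ltxx.
Qed.

Lemma g_bismut X Y Z : g (bismut X Y) Z = bismut_form X Y Z.
Proof.
have lin : linear (bismut_form X Y : L -> R^o).
  move=> a U V; rewrite /bismut_form /c /torsion_form.
  by rewrite !(JE, bE, gE) /GRing.scale /=; ring.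
have [_ _ fX] := hf.
rewrite {2}(fX _ (memvf Z)) (linear_comb _ _ _ lin) form_suml //.
by apply: eq_bigr => i _; rewrite formZl // [RHS]mulrC (sg (f i)).
Qed.

Lemma g_bismut_torsion X Y Z : g X (torsion br bismut Y Z) = - c Y Z X.
Proof.
rewrite sg /torsion !gE !g_bismut /bismut_form /c /torsion_form.
rewrite (br_anti Z Y) (br_anti X Z) (br_anti Y X) (br_anti (J Z) (J Y)).
rewrite (br_anti (J X) (J Z)) (br_anti (J Y) (J X)) !gE; lra.
Qed.

(** Metric compatibility and skewness of the torsion come from the total skewness of c; that J is
    parallel is where integrability enters. *)
Lemma bismut_connectionP : bismut_connection br J g bismut.
Proof.
split.
- move=> Y a U V; apply: nondegenerate => Z; rewrite !gE !g_bismut /bismut_form.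
  by rewrite /c /torsion_form !(JE, bE, gE); ring.
- move=> X a U V; apply: nondegenerate => Z; rewrite !gE !g_bismut /bismut_form.
  by rewrite /c /torsion_form !(JE, bE, gE); ring.
- move=> X Y Z; rewrite (sg Y) !g_bismut /bismut_form /c /torsion_form.
  rewrite (br_anti Z Y) (br_anti X Z) (br_anti Y X) (br_anti (J Z) (J Y)).
  rewrite (br_anti (J X) (J Z)) (br_anti (J Y) (J X)) !gE; lra.
- move=> X Y; apply: nondegenerate => Z.
  have -> : g (J (bismut X Y)) Z = - g (bismut X Y) (J Z) by rewrite -gJ JJ gE.
  rewrite !g_bismut /bismut_form /c /torsion_form !JJ !bE !gE.
  by rewrite (nij X Y) (nij Z X) !(gE, gJ); lra.
- move=> X Y Z; rewrite !g_bismut_torsion /c /torsion_form.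
  rewrite (br_anti (J Z) (J Y)) (br_anti (J X) (J Z)) (br_anti (J Y) (J X)) !gE.
  by split; ring.
Qed.

(** Both second-order terms of the curvature have zero trace by [trace_commutator]. Since [X, Y] and
    J [X, Y] are central, the term along [X, Y] pairs it with [e, Je], half from the Koszul formula
    and half from c. *)
Lemma bismut_ricciP :
  (forall X Y Z, br (br X Y) Z = 0) -> (forall X Y Z, br (J (br X Y)) Z = 0) ->
  bismut_ricci_form br J g
    (fun X Y => 2^-1 * g (br X Y) (\sum_i br (f i) (J (f i)))).
Proof.
move=> z1 z2; exists bismut; first exact: bismut_connectionP.
move=> e eo X Y; have he := frame_onb hg eo.
have [bl br' bm bJ _] := bismut_connectionP.
have skew U V W : g (bismut U V) W = - g V (bismut U W).
  by have := bm U V W => ?; lra.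
congr (2^-1 * _).
have -> : \sum_i br (f i) (J (f i)) = \sum_i br (e i) (J (e i)).
  apply: (onb_contraction (h := fun U V => br U (J V)) hg sg _ _ hf he).
    by move=> Z a U V; rewrite brl.
  by move=> Z a U V; rewrite linearP brr.
rewrite form_sumr //.
have cE i : g (curvature br bismut X Y (e i)) (J (e i)) =
    - g (bismut Y (e i)) (J (bismut X (e i))) + g (bismut X (e i)) (J (bismut Y (e i)))
    + g (br X Y) (br (e i) (J (e i))).
  have h U V : g (bismut U (bismut V (e i))) (J (e i)) =
      - g (bismut V (e i)) (J (bismut U (e i))) by rewrite skew bJ.
  rewrite /curvature !gE !h opprK; congr (_ + _).
  have z3 U V W : br U (J (br V W)) = 0 by rewrite br_anti z2 oppr0.
  have z4 U V W : br U (br V W) = 0 by rewrite br_anti z1 oppr0.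
  rewrite g_bismut /bismut_form /c /torsion_form !(z1, z2, z3, z4) !JJ bE gE.
  by rewrite (br_anti (J (e i))) opprK !gE (sg (br X Y)); lra.
rewrite (eq_bigr _ (fun i _ => cE i)) !big_split /= sumrN.
rewrite (trace_commutator he (skew X) (skew Y) (bJ X)).
rewrite (trace_commutator he (skew Y) (skew X) (bJ Y)).
by rewrite oppr0 !add0r.
Qed.

End Bismut.

(** * Forms and their types *)

Section Forms.
Variables (R : realType) (L : vectType R) (br : L -> L -> L) (J : 'End(L)).

(** Arguments of a form as an explicit list, on which replacing a slot is a [set_nth] and
    computes. *)
Definition vec k (s : seq L) : 'I_k -> L := fun l => nth 0 s l.
Arguments vec k s l : clear implicits.

Lemma slot_proj_vec k (j : 'I_k) b (a : Defs.form L k) (s : seq L) : size s = k ->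
  slot_proj J j b a (vec k s) = 2^-1 * (a (vec k s) +
    (if b then - 'i%C else 'i%C) * a (vec k (set_nth 0 s j (J (nth 0 s j))))).
Proof.
move=> sk; rewrite /slot_proj; congr (_ * (_ + _ * a _)).
by apply/funext => l; rewrite /vec nth_set_nth /= -val_eqE /=; case: eqP => // ->.
Qed.

Lemma ext_d_vec2 (a : Defs.form L 2) x y z : ext_d br a (vec 3 [:: x; y; z]) =
  - a (vec 2 [:: br x y; z]) + a (vec 2 [:: br x z; y]) + a (vec 2 [:: x; br y z]).
Proof.
rewrite /ext_d; under eq_bigr => i _ do rewrite big_mkcond /=.
rewrite !big_ord_recl !big_ord0 /= /bump /= !addn0 !add1n !add0r !addr0.
rewrite expr1 mulN1r expr2 mulN1r opprK !mul1r.
by congr (- a _ + a _ + a _); apply/funext => -[[|[|//]] ?].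
Qed.

Lemma ext_d_vec3 (a : Defs.form L 3) x y z t : ext_d br a (vec 4 [:: x; y; z; t]) =
  - a (vec 3 [:: br x y; z; t]) + a (vec 3 [:: br x z; y; t])
  - a (vec 3 [:: br x t; y; z]) + a (vec 3 [:: x; br y z; t])
  - a (vec 3 [:: x; br y t; z]) - a (vec 3 [:: x; y; br z t]).
Proof.
rewrite /ext_d; under eq_bigr => i _ do rewrite big_mkcond /=.
rewrite !big_ord_recl !big_ord0 /= /bump /= !addn0 !add1n !add0r !addr0.
rewrite expr1 mulN1r expr2 !mulN1r (exprS _ 2) expr2 !mulN1r opprK !mul1r !mulN1r !addrA.
by congr (- a _ + a _ - a _ + a _ - a _ - a _); apply/funext => -[[|[|[|//]]] ?].
Qed.

(** The type decomposition sums over subsets of slots; as a sum over boolean tuples it can be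
    expanded into explicit terms, which the next lemmas do for up to four slots. *)
Lemma sum_set_tuple k (V : nmodType) (F : {set 'I_k} -> V) :
  \sum_(S : {set 'I_k}) F S = \sum_(t : k.-tuple bool) F [set i | tnth t i]%SET.
Proof.
apply: reindex; exists (fun S : {set 'I_k} => [tuple i \in S | i < k]) => [t _|S _].
  by apply: eq_from_tnth => i; rewrite tnth_mktuple inE.
by apply/setP => i; rewrite inE tnth_mktuple.
Qed.

Lemma sum_tupleS k (V : nmodType) (F : seq bool -> V) :
  \sum_(t : k.+1.-tuple bool) F t =
  \sum_(t : k.-tuple bool) F (true :: t) + \sum_(t : k.-tuple bool) F (false :: t).
Proof.
rewrite (reindex (fun p : bool * k.-tuple bool => [tuple of p.1 :: p.2])) /=; last first.
  exists (fun t => (thead t, [tuple of behead t])) => [[b t] _|t _] /=.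
    by congr (_, _); apply: val_inj.
  by apply: val_inj; rewrite /= [in RHS](tuple_eta t).
by rewrite -(pair_big xpredT xpredT (fun b (t : k.-tuple bool) => F (b :: t))) /= big_bool.
Qed.

Lemma sum_tuple0 (V : nmodType) (F : seq bool -> V) :
  \sum_(t : 0.-tuple bool) F t = F [::].
Proof.
rewrite (bigD1 [tuple]) //= big1 ?addr0 // => t /eqP[].
by rewrite [t]tuple0.
Qed.

Lemma sum_tuple1 (V : nmodType) (F : seq bool -> V) :
  \sum_(t : 1.-tuple bool) F t = F [:: true] + F [:: false].
Proof.
by rewrite sum_tupleS (sum_tuple0 (fun s => F (true :: s)))
  (sum_tuple0 (fun s => F (false :: s))).
Qed.

Lemma sum_tuple2 (V : nmodType) (F : seq bool -> V) :
  \sum_(t : 2.-tuple bool) F t =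
  F [:: true; true] + F [:: true; false] + (F [:: false; true] + F [:: false; false]).
Proof.
by rewrite sum_tupleS (sum_tuple1 (fun s => F (true :: s)))
  (sum_tuple1 (fun s => F (false :: s))).
Qed.

Lemma sum_tuple3 (V : nmodType) (F : seq bool -> V) :
  \sum_(t : 3.-tuple bool) F t =
  F [:: true; true; true] + F [:: true; true; false]
  + (F [:: true; false; true] + F [:: true; false; false])
  + (F [:: false; true; true] + F [:: false; true; false]
  + (F [:: false; false; true] + F [:: false; false; false])).
Proof.
by rewrite sum_tupleS (sum_tuple2 (fun s => F (true :: s)))
  (sum_tuple2 (fun s => F (false :: s))).
Qed.

Lemma sum_tuple4 (V : nmodType) (F : seq bool -> V) :
  \sum_(t : 4.-tuple bool) F t =
  F [:: true; true; true; true] + F [:: true; true; true; false]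
  + (F [:: true; true; false; true] + F [:: true; true; false; false])
  + (F [:: true; false; true; true] + F [:: true; false; true; false]
  + (F [:: true; false; false; true] + F [:: true; false; false; false]))
  + (F [:: false; true; true; true] + F [:: false; true; true; false]
  + (F [:: false; true; false; true] + F [:: false; true; false; false])
  + (F [:: false; false; true; true] + F [:: false; false; true; false]
  + (F [:: false; false; false; true] + F [:: false; false; false; false]))).
Proof.
by rewrite sum_tupleS (sum_tuple3 (fun s => F (true :: s)))
  (sum_tuple3 (fun s => F (false :: s))).
Qed.

Definition slot_projs k (a : Defs.form L k) x (s : seq bool) : R[i] :=
  foldr (fun j b => slot_proj J j (nth false s j) b) a (enum 'I_k) x.

Definition typed_slots k p (a : Defs.form L k) x (s : seq bool) : R[i] :=
  if count id s == p then slot_projs a x s else 0.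

Lemma type_part_tuple k p (a : Defs.form L k) x : type_part J p a x =
  \sum_(t : k.-tuple bool) typed_slots p a x t.
Proof.
rewrite /type_part big_mkcond sum_set_tuple; apply: eq_bigr => t _.
rewrite cardsE (_ : #|_| = count id t); last first.
  by rewrite -sum1_card -sum1_count big_tuple; apply: eq_bigl.
rewrite /typed_slots; case: eqP => // _; rewrite /slot_projs; congr (_ x).
elim: (enum 'I_k) => //= j s ->.
by rewrite inE (tnth_nth false).
Qed.

Lemma slot_projs2 (a : Defs.form L 2) x y b1 b2 :
  slot_projs a (vec 2 [:: x; y]) [:: b1; b2] =
  slot_proj J ord0 b1 (slot_proj J (lift ord0 ord0) b2 a) (vec 2 [:: x; y]).
Proof. by rewrite /slot_projs !enum_ordSl /= enum_ord0. Qed.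

Lemma slot_projs3 (a : Defs.form L 3) x y z b1 b2 b3 :
  slot_projs a (vec 3 [:: x; y; z]) [:: b1; b2; b3] =
  slot_proj J ord0 b1 (slot_proj J (lift ord0 ord0) b2
    (slot_proj J (lift ord0 (lift ord0 ord0)) b3 a)) (vec 3 [:: x; y; z]).
Proof. by rewrite /slot_projs !enum_ordSl /= enum_ord0. Qed.

Lemma slot_projs4 (a : Defs.form L 4) x y z t b1 b2 b3 b4 :
  slot_projs a (vec 4 [:: x; y; z; t]) [:: b1; b2; b3; b4] =
  slot_proj J ord0 b1 (slot_proj J (lift ord0 ord0) b2
    (slot_proj J (lift ord0 (lift ord0 ord0)) b3
    (slot_proj J (lift ord0 (lift ord0 (lift ord0 ord0))) b4 a))) (vec 4 [:: x; y; z; t]).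
Proof. by rewrite /slot_projs !enum_ordSl /= enum_ord0. Qed.

Lemma ext_d0 k : ext_d br (fun _ => 0 : R[i]) = (fun _ => 0) :> Defs.form L k.+1.
Proof.
apply/funext => x; rewrite /ext_d big1 // => i _.
by rewrite big1 // => j _; rewrite mulr0.
Qed.

Lemma type_part0 k p : type_part J p (fun _ => 0) = (fun _ => 0) :> Defs.form L k.
Proof.
apply/funext => x; rewrite /type_part big1 // => S _.
suff -> : foldr (fun j b => slot_proj J j (j \in S) b) (fun=> 0) (enum 'I_k) =
  (fun=> 0) by [].
elim: (enum 'I_k) => //= j s ->; apply/funext => y.
by rewrite /slot_proj !mulr0 addr0 mulr0.
Qed.

End Forms.
Arguments vec {R L} k s l.

(** * The SKT condition as closedness of the torsion form *)

Section PluriclosedIdentity.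
Variables (R : realType) (L : vectType R) (br : L -> L -> L).
Variables (J : 'End(L)) (g : L -> L -> R).
Hypothesis brl : forall Z, linear (br^~ Z).
Hypothesis brr : forall X, linear (br X).
Hypothesis br_anti : forall X Y, br X Y = - br Y X.
Hypothesis JJ : forall X, J (J X) = - X.
Hypothesis nij : forall X Y,
  br (J X) (J Y) = br X Y + J (br (J X) Y) + J (br X (J Y)).
Hypothesis hg : bilinear_form g.
Hypothesis sg : forall X Y, g X Y = g Y X.
Hypothesis gJ : forall X Y, g (J X) (J Y) = g X Y.

Let bE := brE brl brr.
Let gE := formE hg.
Let w X Y := g X (J Y).
Let om : Defs.form L 2 := complex_form2 w.

Lemma vec_eta2 (x : 'I_2 -> L) : x = vec 2 [:: x ord0; x (lift ord0 ord0)].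
Proof. by apply/funext => -[[|[|//]] ?]; congr (x _); apply: val_inj. Qed.

Lemma vec_eta3 (x : 'I_3 -> L) :
  x = vec 3 [:: x ord0; x (lift ord0 ord0); x (lift ord0 (lift ord0 ord0))].
Proof. by apply/funext => -[[|[|[|//]]] ?]; congr (x _); apply: val_inj. Qed.

Lemma complex_ext (z t : R[i]) :
  complex.Re z = complex.Re t -> complex.Im z = complex.Im t -> z = t.
Proof. by case: z t => [a b] [c d] /= -> ->. Qed.

Lemma half_complex : (2^-1 : R[i]) = (2^-1)%:C%C.
Proof. by rewrite rmorphV ?unitfE ?pnatr_eq0 //= rmorph_nat. Qed.

(* Locked, so that [half_slot] rewrites innermost slots first. *)
Definition cpx : R -> R -> R[i] := locked (@complex.Complex R).

Lemma cpxE a b : cpx a b = complex.Complex a b.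
Proof. by rewrite /cpx -lock. Qed.

Lemma half_slot (a b a' b' : R) :
  (2^-1 * (cpx a b + - 'i%C * cpx a' b') = cpx (2^-1 * (a + b')) (2^-1 * (b - a'))) *
  (2^-1 * (cpx a b + 'i%C * cpx a' b') = cpx (2^-1 * (a - b')) (2^-1 * (b + a'))).
Proof. by rewrite !cpxE half_complex; split; apply: complex_ext => /=; ring. Qed.

Lemma om_vec X Y : om (vec 2 [:: X; Y]) = cpx (w X Y) 0.
Proof. by rewrite cpxE. Qed.

Lemma type_part_om p : type_part J p om = if p == 1%N then om else fun=> 0.
Proof.
apply/funext => x; rewrite (vec_eta2 x); move: (x _) (x _) => X Y.
rewrite type_part_tuple sum_tuple2 /typed_slots /=.
rewrite !slot_projs2 !slot_proj_vec //= !om_vec !half_slot !cpxE /w !JJ !gE.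
have gJ' U V : g (J U) V = - g U (J V) by rewrite -gJ JJ gE.
rewrite !gJ' !JJ !gE.
by case: p => [|[|[|p]]]; apply: complex_ext; rewrite ?om_vec /w /= ?cpxE /=; lra.
Qed.

Let d_omega X Y Z : R := - w (br X Y) Z + w (br X Z) Y + w X (br Y Z).

Let c := torsion_form br J g.

Lemma ext_d_om X Y Z : ext_d br om (vec 3 [:: X; Y; Z]) = cpx (d_omega X Y Z) 0.
Proof. by rewrite ext_d_vec2 !om_vec !cpxE; apply: complex_ext => /=; rewrite ?oppr0 ?addr0. Qed.

(** This identifies the torsion form c with d^c omega, up to the sign convention for d^c. *)
Lemma d_omega_J X Y Z : d_omega (J X) (J Y) (J Z) = c X Y Z.
Proof.
rewrite /d_omega /w /c /torsion_form !JJ !gE gJ (br_anti (J Z)) !gE (sg X); ring.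
Qed.

(* [omega] has type (1,1) and [J] is integrable, so [d omega] has no component
   of type (3,0) or (0,3). *)
Lemma d_omega_type X Y Z : d_omega X Y Z =
  d_omega (J X) (J Y) Z + d_omega (J X) Y (J Z) + d_omega X (J Y) (J Z).
Proof.
have gJ' U V : g (J U) V = - g U (J V) by rewrite -gJ JJ gE.
rewrite /d_omega /w (nij X Y) (nij X Z) (nij Y Z) !(linearD, JJ) /= !(bE, gE, gJ, gJ').
rewrite !JJ !gE.
lra.
Qed.

Let pJN X : J (- X) = - J X. Proof. exact: linearN. Qed.

Lemma d_omegaN1 X Y Z : d_omega (- X) Y Z = - d_omega X Y Z.
Proof. by rewrite /d_omega /w !(bE, gE, pJN); ring. Qed.

Lemma d_omegaN2 X Y Z : d_omega X (- Y) Z = - d_omega X Y Z.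
Proof. by rewrite /d_omega /w !(bE, gE, pJN); ring. Qed.

Lemma d_omegaN3 X Y Z : d_omega X Y (- Z) = - d_omega X Y Z.
Proof. by rewrite /d_omega /w !(bE, gE, pJN); ring. Qed.

(** The (1,2)-part of d omega, namely half of d omega + i c: precomposition with J in all slots
    multiplies the (2,1)-part by i and the (1,2)-part by - i. *)
Let tau : Defs.form L 3 := fun x =>
  let X := x ord0 in let Y := x (lift ord0 ord0) in
  let Z := x (lift ord0 (lift ord0 ord0)) in
  complex.Complex (2^-1 * d_omega X Y Z) (2^-1 * d_omega (J X) (J Y) (J Z)).

Lemma delbar_om : delbar br J om = tau.
Proof.
apply/funext => x; rewrite /delbar !big_ord_recl big_ord0 !type_part_om /=.
rewrite !ext_d0 !type_part0 addr0 add0r addr0 (vec_eta3 x).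
move: (x _) (x _) (x _) => Z Y X.
rewrite type_part_tuple sum_tuple3 /typed_slots /=.
rewrite !slot_projs3 !slot_proj_vec //= !ext_d_om !half_slot !cpxE /= /tau /vec /=.
have := d_omega_type X Y Z; have := d_omega_type (J X) (J Y) (J Z).
rewrite !JJ !(d_omegaN1, d_omegaN2, d_omegaN3) => h1 h2.
by apply: complex_ext => /=; lra.
Qed.

Lemma tau_vec X Y Z : tau (vec 3 [:: X; Y; Z]) =
  cpx (2^-1 * d_omega X Y Z) (2^-1 * c X Y Z).
Proof. by rewrite cpxE /tau /= /vec /= d_omega_J. Qed.

Lemma type_part_tau p : type_part J p tau = if p == 1%N then tau else fun=> 0.
Proof.
apply/funext => x; rewrite (vec_eta3 x).
move: (x _) (x _) (x _) => Z Y X.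
rewrite type_part_tuple sum_tuple3 /typed_slots /=.
rewrite !slot_projs3 !slot_proj_vec //= !tau_vec !half_slot !cpxE -?d_omega_J.
rewrite !JJ !(d_omegaN1, d_omegaN2, d_omegaN3).
have := d_omega_type X Y Z; have := d_omega_type (J X) (J Y) (J Z).
rewrite !JJ !(d_omegaN1, d_omegaN2, d_omegaN3) => h1 h2.
by case: p => [|[|[|[|p]]]]; rewrite ?tau_vec ?cpxE -?d_omega_J; apply: complex_ext => /=; lra.
Qed.

Lemma del_tau : del br J tau = type_part J 2 (ext_d br tau).
Proof.
apply/funext => x; rewrite /del !big_ord_recl big_ord0 !type_part_tau /=.
by rewrite !ext_d0 !type_part0 !addr0 add0r.
Qed.

Let d_torsion X Y Z T : R :=
  - c (br X Y) Z T + c (br X Z) Y T - c (br X T) Y Z + c X (br Y Z) T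
  - c X (br Y T) Z - c X Y (br Z T).

Let dd_omega X Y Z T : R :=
  - d_omega (br X Y) Z T + d_omega (br X Z) Y T - d_omega (br X T) Y Z + d_omega X (br Y Z) T
  - d_omega X (br Y T) Z - d_omega X Y (br Z T).

Lemma ext_d_tau X Y Z T : ext_d br tau (vec 4 [:: X; Y; Z; T]) =
  cpx (2^-1 * dd_omega X Y Z T) (2^-1 * d_torsion X Y Z T).
Proof.
by rewrite ext_d_vec3 !tau_vec !cpxE; apply: complex_ext; rewrite /= /dd_omega /d_torsion; ring.
Qed.

Lemma torsion_form_cyc X Y Z : c X Y Z = c Y Z X.
Proof. by rewrite /c /torsion_form; ring. Qed.

Lemma torsion_form_anti X Y Z : c X Y Z = - c Y X Z.
Proof.
rewrite /c /torsion_form (br_anti (J X) (J Y)) (br_anti (J Y) (J Z)).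
by rewrite (br_anti (J Z) (J X)) !gE; ring.
Qed.

Lemma torsion_formN X Y Z : ((c (- X) Y Z = - c X Y Z) * (c X (- Y) Z = - c X Y Z) *
  (c X Y (- Z) = - c X Y Z))%type.
Proof. by do !split; rewrite /c /torsion_form !(pJN, bE, gE); ring. Qed.

Lemma d_torsionN X Y Z T :
  ((d_torsion (- X) Y Z T = - d_torsion X Y Z T) *
  (d_torsion X (- Y) Z T = - d_torsion X Y Z T) *
  (d_torsion X Y (- Z) T = - d_torsion X Y Z T) *
  (d_torsion X Y Z (- T) = - d_torsion X Y Z T))%type.
Proof. by do !split; rewrite /d_torsion !(bE, torsion_formN); ring. Qed.

Lemma d_torsion_anti12 X Y Z T : d_torsion X Y Z T = - d_torsion Y X Z T.
Proof.
rewrite /d_torsion (br_anti Y X) (torsion_form_anti Y X) torsion_formN.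
rewrite (torsion_form_anti X (br Y Z)) (torsion_form_anti X (br Y T))
  (torsion_form_anti Y (br X Z)) (torsion_form_anti Y (br X T)).
by ring.
Qed.

Lemma d_torsion_anti34 X Y Z T : d_torsion X Y Z T = - d_torsion X Y T Z.
Proof.
rewrite /d_torsion (br_anti T Z) torsion_formN (torsion_form_cyc (br X Y)) (torsion_form_anti Z T)
  -(torsion_form_cyc (br X Y)).
by ring.
Qed.

(** On arguments X, JX, Y, JY spanning two complex lines, only the (2,2)-part of a 4-form is seen.
    The projection to type (2,2) is real, so the imaginary part of the equation is half of dc. *)
Theorem d_torsion_form_eq0 X Y :
  (forall x, del br J (delbar br J om) x = 0) -> d_torsion_form br J g X Y = 0.
Proof.
have z12 U V W : d_torsion U U V W = 0 by have := d_torsion_anti12 U U V W; lra.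
have z34 U V W : d_torsion V W U U = 0 by have := d_torsion_anti34 V W U U; lra.
move=> /(_ (vec 4 [:: X; J X; Y; J Y])); rewrite delbar_om del_tau.
rewrite type_part_tuple sum_tuple4 /typed_slots /=.
rewrite !slot_projs4 !slot_proj_vec //= !ext_d_tau !half_slot !cpxE.
move=> /(congr1 (@complex.Im _)) /=; rewrite !JJ !d_torsionN => E.
rewrite !(z12, z34) !(d_torsion_anti12 (J X) X) !(d_torsion_anti34 _ _ (J Y) Y) in E.
have {E} : 2^-1 * d_torsion X (J X) Y (J Y) = 0 by rewrite -[RHS]E; field.
rewrite /d_torsion (torsion_form_anti X (br _ Y)) (torsion_form_anti X (br _ (J Y))).
rewrite -(torsion_form_cyc (br Y (J Y))) /d_torsion_form -/c => E; lra.
Qed.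

End PluriclosedIdentity.

(** * Ordinary differential equations *)

Section RealAnalysis.
Variable R : realType.
Local Notation mu := (@lebesgue_measure R).

(** The integral from 0 to t for t of either sign, taken from a base point a to the left of both. *)
Definition antiderivative (a : R) (F : R -> R) (t : R) : R :=
  \int[mu]_(s in `[a, t]) F s - \int[mu]_(s in `[a, 0]) F s.

Lemma is_derive_antiderivative (a : R) (F : R -> R) : continuous F ->
  forall t : R, a < t ->
  is_derive t (1 : R) (antiderivative a F) (F t).
Proof.
move=> cF t at_.
have t1 : t < t + 1 by rewrite ltrDl.
have iF : mu.-integrable `[a, t + 1] (EFin \o F).
  apply: continuous_compact_integrable; first exact: segment_compact.
  exact: continuous_subspaceT.
have [dF F'] := continuous_FTC1_closed t1 iF at_ (cF t).
have h1 : is_derive t (1 : R) (fun x => \int[mu]_(s in `[a, x]) F s) (F t).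
  by apply: DeriveDef; rewrite -?derive1E.
have := is_deriveB h1 (is_derive_cst (\int[mu]_(s in `[a, 0]) F s) t (1 : R)).
by rewrite subr0; apply.
Qed.

(** By the mean value theorem psi + phi and psi - phi are nondecreasing. *)
Lemma derive_dominated (phi psi dphi dpsi : R -> R) (s t : R) : s <= t ->
  (forall r : R, s <= r <= t -> is_derive r (1 : R) phi (dphi r)) ->
  (forall r : R, s <= r <= t -> is_derive r (1 : R) psi (dpsi r)) ->
  (forall r : R, s <= r <= t -> `|dphi r| <= dpsi r) ->
  `|phi t - phi s| <= psi t - psi s.
Proof.
move=> st hphi hpsi le.
have mono (f df : R -> R) : (forall r : R, s <= r <= t -> is_derive r (1 : R) f (df r)) ->
    (forall r : R, s <= r <= t -> 0 <= df r) -> f s <= f t.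
  move=> hf df0.
  have [||r rI E] := @MVT_segment R f df s t st.
  - by move=> r /[!in_itv]/= /andP[sr rt]; apply: hf; rewrite !ltW.
  - apply: derivable_within_continuous => r /[!in_itv]/= sr.
    by have [] := hf r sr.
  rewrite -subr_ge0 E mulr_ge0 ?subr_ge0 //; apply: df0.
  by move: rI; rewrite in_itv.
rewrite ler_norml; apply/andP; split.
  have := mono (psi \+ phi) (fun r => dpsi r + dphi r).
  move=> /(_ _ _)/wrap[r rI|r rI|]; last by rewrite /=; lra.
    have := hphi r rI; have := hpsi r rI => ? ?; exact: is_deriveD.
  by have := le r rI; rewrite ler_norml => /andP[]; lra.
have := mono (psi \- phi) (fun r => dpsi r - dphi r).
move=> /(_ _ _)/wrap[r rI|r rI|]; last by rewrite /=; lra.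
  have := hphi r rI; have := hpsi r rI => ? ?; exact: is_deriveB.
by have := le r rI; rewrite ler_norml => /andP[]; lra.
Qed.

(** A quadratic remainder bound passes to pointwise limits when its constant is uniform; this lemma
    then recovers the derivative of the limit. *)
Lemma is_derive_quadratic (phi : R -> R) (a s l Q : R) : a < s ->
  (forall t, a <= t -> `|phi t - phi s - (t - s) * l| <= Q * (t - s) ^+ 2) ->
  is_derive s (1 : R) phi l.
Proof.
move=> as_ hQ.
suff h : h^-1 *: (phi (h *: (1 : R) + s) - phi s) @[h --> 0^'] --> l.
  apply: DeriveDef; first by apply/cvg_ex; exists l.
  exact/cvg_lim.
apply/cvgrPdist_le => e e0.
have Q0 : 0 < `|Q| + 1 by rewrite ltr_pwDr.
near=> h.
have h0 : h != 0 by near: h; exact: nbhs_dnbhs_neq.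
have hs : `|h| < s - a.
  by near: h; apply: dnbhs0_lt; rewrite subr_gt0.
have he : `|h| <= e / (`|Q| + 1).
  by near: h; apply: dnbhs0_le; rewrite divr_gt0.
have := hQ (h + s).
rewrite addrK /GRing.scale /= mulr1 => /(_ _)/wrap[|qh].
  by move: hs; rewrite ltr_norml => /andP[]; lra.
rewrite -(ler_pM2l (x := `|h|)) ?normr_gt0 // -normrM mulrBr mulrA divff // mul1r.
rewrite distrC; apply: (le_trans qh).
rewrite -(real_normK (num_real h)) expr2 mulrA (mulrC `|h|) ler_wpM2r //.
apply: (le_trans (y := (`|Q| + 1) * `|h|)).
  by rewrite ler_wpM2r // (le_trans (ler_norm _)) // lerDl.
by rewrite mulrC -ler_pdivlMr.
Unshelve. all: by end_near. Qed.

Lemma cvg_geometric_increments (v : R ^nat) (A : R) :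
  (forall n, `|v n.+1 - v n| <= A * 2^-1 ^+ n) -> cvgn v.
Proof.
move=> hv.
have E : v = (fun n => v 0%N + series (telescope v) n).
  by apply/funext => n; rewrite -eq_sum_telescope.
rewrite E; apply: is_cvgD; first exact: is_cvg_cst.
apply: normed_cvg; apply: (@series_le_cvg _ _ (geometric A 2^-1)) => //.
- by move=> n; rewrite /=.
- move=> n; rewrite /geometric /= mulr_ge0 ?exprn_ge0 ?invr_ge0 //.
  by have := hv 0%N; rewrite expr0 mulr1; apply: le_trans.
- by apply: is_cvg_geometric_series; rewrite ger0_norm; lra.
Qed.

End RealAnalysis.

(** * Picard iteration on a half-line *)

Section Picard.
Variables (R : realType) (d : nat).
Local Notation state := ('I_d -> R).
Variables (K : state -> Prop) (f : state -> state) (C M eps : R).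
Hypothesis eps0 : 0 < eps.
Hypothesis C0 : 0 <= C.
Hypothesis K0 : K (fun=> 0).
Hypothesis K_closed : forall (u : nat -> state) (v : state), (forall n, K (u n)) ->
  (forall i, u n i @[n --> \oo] --> v i) -> K v.
Hypothesis f_bound : forall u i, K u -> `|f u i| <= M.
Hypothesis f_lip : forall u v i, K u -> K v ->
  `|f u i - f v i| <= C * \sum_j `|u j - v j|.
(** Invariance is required of the iteration: the velocity of V is f along another curve U in K. It
    keeps every iterate in the region where f is bounded and Lipschitz. *)
Hypothesis K_invariant : forall U V : R -> state, (forall t : R, - eps <= t -> K (U t)) ->
  (forall i, V 0 i = 0) ->
  (forall (t : R) i, - eps <= t -> is_derive t (1 : R) (fun s => V s i) (f (U t) i)) ->
  forall t : R, - eps <= t -> K (V t).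

(** Freezes a curve to the left of - eps, so that the integrands are continuous on the whole
    line. *)
Let clamp (t : R) : R := Num.max t (- eps).

(** The base point - eps - 1 lies strictly to the left of - eps, so the derivative at - eps is
    two-sided as well. *)
Definition picard_step (U : R -> state) (t : R) : state := fun i =>
  antiderivative (- eps - 1) (fun s => f (U (clamp s)) i) t -
  antiderivative (- eps - 1) (fun s => f (U (clamp s)) i) 0.

Fixpoint picard (n : nat) : R -> state :=
  if n is n'.+1 then picard_step (picard n') else fun _ _ => 0.

Let adm (U : R -> state) : Prop := forall t : R, - eps <= t ->
  K (U t) /\ forall i, {for t, continuous (fun s => U s i)}.

Let M0 : d = 0%N \/ 0 <= M.
Proof.
case: (posnP d) => [->|d0]; [by left | right].
exact: le_trans (normr_ge0 _) (f_bound (Ordinal d0) K0).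
Qed.

Lemma clamp_ge (t : R) : - eps <= clamp t.
Proof. by rewrite /clamp le_max lexx orbT. Qed.

Lemma clamp_id (t : R) : - eps <= t -> clamp t = t.
Proof. by move=> h; rewrite /clamp; apply/max_idPl. Qed.

Lemma continuous_clamp : continuous clamp.
Proof.
move=> t; apply: (@continuous_max _ _ (fun r : R => r) (fun=> - eps)).
  exact: cvg_id.
exact: cvg_cst.
Qed.

Lemma f_clamp_continuous U i : adm U -> continuous (fun s => f (U (clamp s)) i).
Proof.
move=> hU s; have [Ks cs] := hU _ (clamp_ge s).
have cj j : U (clamp r) j @[r --> s] --> U (clamp s) j.
  apply: (@continuous_comp _ _ _ clamp (fun r => U r j)); first exact: continuous_clamp.
  exact: cs.
have c0 : C * \sum_j `|U (clamp s) j - U (clamp r) j| @[r --> s] -->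
    C * \sum_(j < d) `|U (clamp s) j - U (clamp s) j|.
  apply: cvgM; first exact: cvg_cst.
  apply: cvg_big => [|j _]; first exact: add_continuous.
  apply: cvg_norm; apply: cvgB; first exact: cvg_cst.
  exact: cj.
rewrite big1 ?mulr0 in c0; last by move=> j _; rewrite subrr normr0.
apply/cvgrPdist_le => e e0; move/cvgrPdist_le/(_ _ e0): c0.
apply: filterS => r; rewrite sub0r normrN => le.
have [Kr _] := hU _ (clamp_ge r).
apply: le_trans (f_lip i Ks Kr) _; apply: le_trans (ler_norm _) le.
Qed.

Lemma picard_step_derive U (t : R) i : adm U -> - eps <= t ->
  is_derive t (1 : R) (fun s => picard_step U s i) (f (U t) i).
Proof.
move=> hU ht; have ht1 : - eps - 1 < t by lra.
have h := is_derive_antiderivative (f_clamp_continuous (i := i) hU) ht1.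
rewrite clamp_id // in h.
have := is_deriveB h (is_derive_cst
  (antiderivative (- eps - 1) (fun s => f (U (clamp s)) i) 0) t (1 : R)).
by rewrite subr0; apply.
Qed.

Lemma picard_adm n : adm (picard n).
Proof.
elim: n => [|n IH] t ht /=; first by split=> // i; exact: cst_continuous.
split.
  apply: (K_invariant (U := picard n)) => // [s hs|i|s i hs].
  - by have [] := IH _ hs.
  - by rewrite /picard_step subrr.
  - exact: picard_step_derive.
move=> i; have [h _] := picard_step_derive i IH ht.
exact/differentiable_continuous/derivable1_diffP.
Qed.

Lemma picard_derive n (t : R) i : - eps <= t ->
  is_derive t (1 : R) (fun s => picard n.+1 s i) (f (picard n t) i).
Proof. by move=> ht; apply: picard_step_derive => //; exact: picard_adm. Qed.

Lemma picard_K n (t : R) : - eps <= t -> K (picard n t).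
Proof. by move=> ht; have [] := picard_adm n ht. Qed.

Lemma picard_0 n i : picard n 0 i = 0.
Proof. by case: n => //= n; rewrite /picard_step subrr. Qed.

Lemma picard_lipschitz n i (s t : R) : - eps <= s -> s <= t ->
  `|picard n t i - picard n s i| <= M * (t - s).
Proof.
move=> hs st.
have M0' : 0 <= M by case: M0 => // d0; move: i; rewrite d0 => -[].
case: n => [|n]; first by rewrite subrr normr0 mulr_ge0 // subr_ge0.
rewrite mulrBr.
apply: (@derive_dominated R (fun r => picard n.+1 r i) (fun r => M * r)
  (fun r => f (picard n r) i) (fun=> M) s t st).
- by move=> r /andP[sr _]; apply: picard_derive; exact: le_trans sr.
- move=> r _; have := is_deriveZ M (is_derive_id r (1 : R)).
  by rewrite /GRing.scale /= mulr1; apply.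
- by move=> r /andP[sr _]; apply: f_bound; apply: picard_K; exact: le_trans sr.
Qed.

(** An exponential weight E, symmetric in time, with primitive S vanishing at 0. Integration gains a
    factor 1 / a against E, and C d / a <= 1/2, so a Picard step halves weighted distances on the
    whole half-line. *)
Let a : R := 2 * C * d%:R + 1.
Let E t : R := expR (a * t) + expR (- a * t).
Let S t : R := a^-1 * (expR (a * t) - expR (- a * t)).

Lemma weight_gt0 : 0 < a.
Proof. by rewrite /a ltr_wpDl // !mulr_ge0. Qed.

Lemma is_derive_weight t : is_derive t (1 : R) S (E t).
Proof.
have lin (b : R) : is_derive t (1 : R) (fun r => b * r) b.
  have := is_deriveZ b (is_derive_id t (1 : R)).
  by rewrite /GRing.scale /= mulr1; apply.
have ex (b : R) : is_derive t (1 : R) (fun r => expR (b * r)) (b * expR (b * t)).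
  have h := is_derive1_comp (is_derive_expR (b * t)) (lin b).
  by rewrite mulrC; exact: h.
have := is_deriveZ a^-1 (is_deriveB (ex a) (ex (- a))).
have -> : a^-1 *: (a * expR (a * t) - - a * expR (- a * t)) = E t.
  by rewrite /GRing.scale /= mulNr opprK -mulrDr mulKf // gt_eqF // weight_gt0.
by apply.
Qed.

Lemma weight_ge1 t : 1 <= E t.
Proof.
have := expR_gt0 (a * t); have := expR_gt0 (- a * t) => h1 h2.
have [t0|t0] := leP 0 t.
  have : 1 <= expR (a * t); last by rewrite /E; lra.
  by rewrite -expR0 ler_expR mulr_ge0 // ltW // weight_gt0.
have : 1 <= expR (- a * t); last by rewrite /E; lra.
by rewrite -expR0 ler_expR mulNr -mulrN mulr_ge0 ?oppr_ge0 // ltW // weight_gt0.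
Qed.

Lemma weight_bound t : `|S t| <= a^-1 * E t.
Proof.
have a0 := weight_gt0.
have := expR_gt0 (a * t); have := expR_gt0 (- a * t) => h1 h2.
rewrite /S normrM gtr0_norm ?invr_gt0 //.
apply: ler_wpM2l; first by rewrite invr_ge0 ltW.
by rewrite /E ler_norml; apply/andP; split; lra.
Qed.

Lemma weighted_bound (phi dphi : R -> R) (k t : R) : 0 <= k -> phi 0 = 0 ->
  (forall s : R, - eps <= s -> is_derive s (1 : R) phi (dphi s)) ->
  (forall s : R, - eps <= s -> `|dphi s| <= k * E s) ->
  - eps <= t -> `|phi t| <= k / a * E t.
Proof.
move=> k0 phi0 hphi hk ht.
have dS (r : R) : is_derive r (1 : R) (fun r => k * S r) (k * E r).
  by have := is_deriveZ k (is_derive_weight r); apply.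
have S0 : S 0 = 0 by rewrite /S !mulr0 subrr mulr0.
suff : `|phi t| <= k * `|S t|.
  move=> h; apply: (le_trans h); rewrite -mulrA ler_wpM2l //; exact: weight_bound.
have [t0|t0] := leP 0 t.
  have := @derive_dominated _ phi (fun r => k * S r) dphi (fun r => k * E r) 0 t t0.
  rewrite S0 mulr0 phi0 !subr0 => /(_ _ _ _)/wrap[r /andP[r0 _]|r /andP[r0 _]|].
  - by apply: hphi; apply: le_trans r0; rewrite oppr_le0 ltW.
  - by apply: hk; apply: le_trans r0; rewrite oppr_le0 ltW.
  - by move=> h; apply: (le_trans h); rewrite ler_wpM2l // ler_norm.
have := @derive_dominated _ phi (fun r => k * S r) dphi (fun r => k * E r) t 0 (ltW t0).
rewrite S0 mulr0 phi0 !sub0r normrN => /(_ _ _ _)/wrap[r /andP[r0 _]|r /andP[r0 _]|].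
- by apply: hphi; exact: le_trans ht r0.
- by apply: hk; exact: le_trans ht r0.
- by move=> h; apply: (le_trans h); rewrite -mulrN -normrN ler_wpM2l // ler_norm.
Qed.

Lemma picard_increment n (t : R) i : - eps <= t ->
  `|picard n.+1 t i - picard n t i| <= M * E t * 2^-1 ^+ n.
Proof.
move=> ht; have M0' : 0 <= M by case: M0 => // d0; move: i; rewrite d0 => -[].
have a0 := weight_gt0.
have a1 : 1 <= a by rewrite /a lerDr !mulr_ge0.
elim: n t i ht => [|n IH] t i ht.
  rewrite expr0 mulr1 subr0.
  have := @weighted_bound (fun s => picard 1 s i) (fun s => f (picard 0 s) i) M t M0'
    (picard_0 1 i) (fun s => @picard_derive 0 s i) _ ht.
  move=> /(_ _)/wrap[s hs|h].
    apply: le_trans (f_bound i (picard_K 0 hs)) _.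
    by rewrite ler_peMr // weight_ge1.
  apply: (le_trans h); rewrite ler_wpM2r ?(le_trans _ (weight_ge1 t)) //.
  by rewrite ler_pdivrMr // ler_peMr.
pose k := C * d%:R * M * 2^-1 ^+ n.
have k0 : 0 <= k by rewrite /k !mulr_ge0 // exprn_ge0 // invr_ge0.
have := @weighted_bound (fun s => picard n.+2 s i - picard n.+1 s i)
  (fun s => f (picard n.+1 s) i - f (picard n s) i) k t k0.
rewrite !picard_0 subrr => /(_ erefl _ _ ht)/wrap[s hs|s hs|h].
- have h1 := @picard_derive n.+1 s i hs; have h2 := @picard_derive n s i hs.
  exact: is_deriveB.
- apply: le_trans (f_lip i (picard_K _ hs) (picard_K _ hs)) _.
  rewrite /k -!mulrA ler_wpM2l //.
  apply: (le_trans (y := \sum_(j < d) M * E s * 2^-1 ^+ n)).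
    by apply: ler_sum => j _; exact: IH.
  by rewrite sumr_const card_ord -(mulr_natl _ d) le_eqVlt; apply/orP; left; apply/eqP; ring.
- apply: (le_trans h); rewrite exprS /k.
  have e0 : 0 <= E t by apply: le_trans (weight_ge1 t).
  rewrite [leRHS](_ : _ = (2^-1 * (M * 2^-1 ^+ n)) * E t); last by ring.
  rewrite ler_wpM2r // ler_pdivrMr //.
  rewrite [leRHS](_ : _ = (2^-1 * a) * (M * 2^-1 ^+ n)); last by ring.
  rewrite [leLHS](_ : _ = (C * d%:R) * (M * 2^-1 ^+ n)); last by ring.
  rewrite ler_wpM2r //; last by rewrite /a; lra.
  by rewrite mulr_ge0 // exprn_ge0 // invr_ge0.
Qed.

(** The increments are summable at each time, which gives a pointwise limit. Its derivative is found
    without exchanging limit and integral, from a quadratic remainder estimate for the iterates that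
    is uniform in n. *)
Theorem picard_lindelof : exists U : R -> state,
  [/\ forall i, U 0 i = 0, forall t : R, - eps <= t -> K (U t) &
      forall (t : R) i, - eps < t -> is_derive t (1 : R) (fun s => U s i) (f (U t) i)].
Proof.
pose U t i := limn (fun n => picard n t i).
have cU t i : - eps <= t -> picard n t i @[n --> \oo] --> U t i.
  move=> ht; apply: (@cvg_geometric_increments _ (fun n => picard n t i) (M * E t)).
  by move=> n; exact: picard_increment.
have KU t : - eps <= t -> K (U t).
  by move=> ht; apply: (K_closed (u := fun n => picard n t)) => [n|i];
    [exact: picard_K|exact: cU].
exists U; split=> //.
  move=> i; rewrite /U (_ : (fun n => _) = fun=> 0) ?lim_cst //.
  by apply/funext => n; rewrite picard_0.
move=> s i hs; have hs' := ltW hs.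
have M0' : 0 <= M by case: M0 => // d0; move: i; rewrite d0 => -[].
pose Q := C * (d%:R * M).
have Q0 : 0 <= Q by rewrite !mulr_ge0.
(* Iterates are M-Lipschitz in time, so the velocity of the next iterate varies by at most Q |t - s|
   between s and t. *)
have quad n t : - eps <= t ->
    `|picard n.+1 t i - picard n.+1 s i - (t - s) * f (picard n s) i| <= Q * (t - s) ^+ 2.
  move=> ht; pose l := f (picard n s) i.
  pose phi r := picard n.+1 r i - l * r.
  have dphi r : - eps <= r -> is_derive r (1 : R) phi (f (picard n r) i - l).
    move=> hr; have h1 := @picard_derive n r i hr.
    have h2 := is_deriveZ l (is_derive_id r (1 : R)).
    by rewrite /GRing.scale /= mulr1 in h2; exact: is_deriveB.
  have lipn r j : - eps <= r -> `|picard n r j - picard n s j| <= M * `|r - s|.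
    move=> hr; have [rs|sr] := leP r s.
      by rewrite distrC (distrC r) (ger0_norm (x := s - r)) ?subr_ge0 // picard_lipschitz.
    by rewrite (ger0_norm (x := r - s)) ?subr_ge0 ?picard_lipschitz // ltW.
  have bd r : - eps <= r -> `|r - s| <= `|t - s| -> `|f (picard n r) i - l| <= Q * `|t - s|.
    move=> hr rt; apply: le_trans (f_lip i (picard_K n hr) (picard_K n hs')) _.
    rewrite /Q -!mulrA ler_wpM2l //.
    apply: (le_trans (y := \sum_(j < d) M * `|t - s|)).
      by apply: ler_sum => j _; apply: le_trans (lipn r j hr) _; rewrite ler_wpM2l.
    by rewrite sumr_const card_ord -[leLHS]mulr_natl.
  have dQ (q r : R) : is_derive r (1 : R) (fun r => q * r) q.
    have := is_deriveZ q (is_derive_id r (1 : R)).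
    by rewrite /GRing.scale /= mulr1; apply.
  have -> : picard n.+1 t i - picard n.+1 s i - (t - s) * f (picard n s) i =
      phi t - phi s by rewrite /phi -/l; ring.
  rewrite -(real_normK (num_real (t - s))) expr2 mulrA.
  have [ts|/ltW st] := leP t s.
    rewrite (distrC (phi t)) (distrC t) (ger0_norm (x := s - t)) ?subr_ge0 //.
    rewrite [leRHS](mulrBr (Q * (s - t))).
    apply: (@derive_dominated _ phi (fun r => Q * (s - t) * r)
      (fun r => f (picard n r) i - l) (fun=> Q * (s - t)) t s ts).
    - by move=> r /andP[tr _]; apply: dphi; exact: le_trans tr.
    - move=> r /andP[tr rs]; rewrite -(ger0_norm (x := s - t)) ?subr_ge0 // (distrC s).
      apply: bd; first exact: le_trans tr.
      by rewrite distrC (distrC t) !ger0_norm ?subr_ge0 // lerB.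
  rewrite (ger0_norm (x := t - s)) ?subr_ge0 // [leRHS](mulrBr (Q * (t - s))).
  apply: (@derive_dominated _ phi (fun r => Q * (t - s) * r)
    (fun r => f (picard n r) i - l) (fun=> Q * (t - s)) s t st).
  - by move=> r /andP[sr _]; apply: dphi; exact: le_trans sr.
  - move=> r /andP[sr rt]; rewrite -(ger0_norm (x := t - s)) ?subr_ge0 //.
    apply: bd; first exact: le_trans sr.
    by rewrite !ger0_norm ?subr_ge0 // lerB.
apply: (@is_derive_quadratic _ _ (- eps) s _ Q hs) => t ht.
have cf : f (picard n s) i @[n --> \oo] --> f (U s) i.
  have c0 : C * \sum_j `|U s j - picard n s j| @[n --> \oo] -->
      C * \sum_(j < d) `|U s j - U s j|.
    apply: cvgM; first exact: cvg_cst.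
    apply: cvg_big => [|j _]; first exact: add_continuous.
    apply: cvg_norm; apply: cvgB; first exact: cvg_cst.
    exact: cU.
  rewrite big1 ?mulr0 in c0; last by move=> j _; rewrite subrr normr0.
  apply/cvgrPdist_le => e e0; move/cvgrPdist_le/(_ _ e0): c0.
  apply: filterS => r; rewrite sub0r normrN => le.
  apply: le_trans (f_lip i (KU _ hs') (picard_K r hs')) _.
  by apply: le_trans (ler_norm _) le.
have lhs : `|picard n.+1 t i - picard n.+1 s i - (t - s) * f (picard n s) i| @[n --> \oo]
    --> `|U t i - U s i - (t - s) * f (U s) i|.
  apply: cvg_norm; apply: cvgB; last by apply: cvgM; [exact: cvg_cst|exact: cf].
  by apply: cvgB; [rewrite (cvg_shiftS (fun n => picard n t i))|
    rewrite (cvg_shiftS (fun n => picard n s i))]; exact: cU.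
rewrite -(cvg_lim _ lhs) //; apply: limr_le; first by apply/cvg_ex; eexists; exact: lhs.
by near=> n; exact: quad.
Unshelve. all: by end_near. Qed.

End Picard.

(** * The flow *)

Section Flow.
Variables (R : realType) (L : vectType R) (br : L -> L -> L).
Variables (J : 'End(L)) (g : L -> L -> R).
Hypothesis brl : forall Z, linear (br^~ Z).
Hypothesis brr : forall X, linear (br X).
Hypothesis br_anti : forall X Y, br X Y = - br Y X.
Hypothesis JJ : forall X, J (J X) = - X.
Hypothesis nij : forall X Y,
  br (J X) (J Y) = br X Y + J (br (J X) Y) + J (br X (J Y)).
Hypothesis hg : bilinear_form g.
Hypothesis sg : forall X Y, g X Y = g Y X.
Hypothesis pg : forall X, X != 0 -> 0 < g X X.
Hypothesis gJ : forall X Y, g (J X) (J Y) = g X Y.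
Hypothesis br_br : forall X Y Z, br (br X Y) Z = 0.
Hypothesis br_Jbr : forall X Y Z, br (J (br X Y)) Z = 0.
Hypothesis skt_ge0 : forall X Y, 0 <= g (br X (J X)) (br Y (J Y)).

Local Notation n := (\dim {:L}).
Local Notation state := ('I_n -> R).
Variable e : 'I_n -> L.
Hypothesis he : onb g {:L}%VS e.

Let bE := brE brl brr.
Let gE := formE hg.
Let fJD X Y : J (X + Y) = J X + J Y. Proof. exact: linearD. Qed.
Let fJZ a X : J (a *: X) = a *: J X. Proof. exact: linearZ. Qed.
Let fJN X : J (- X) = - J X. Proof. exact: linearN. Qed.
Let JE := (fJD, fJZ, fJN).

(** The polarisation of X |-> [X, JX]. It is symmetric and J-invariant, so adding its components to
    g keeps the form symmetric and J-invariant. *)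
Definition bracket11 X Y : L := 2^-1 *: (br X (J Y) - br (J X) Y).

Lemma bracket11_linearl Z : linear (bracket11^~ Z).
Proof.
move=> a X Y; rewrite /bracket11 !(JE, bE) opprD addrACA -scalerBr scalerDr.
by rewrite !scalerA mulrC.
Qed.

Lemma bracket11C X Y : bracket11 X Y = bracket11 Y X.
Proof. by rewrite /bracket11 (br_anti Y) (br_anti (J Y)) opprK addrC. Qed.

Lemma bracket11_linearr X : linear (bracket11 X).
Proof. by move=> a Y Z; rewrite !(bracket11C X) bracket11_linearl. Qed.

Lemma bracket11J X Y : bracket11 (J X) (J Y) = bracket11 X Y.
Proof. by rewrite /bracket11 !JJ !bE opprK addrC. Qed.

Lemma bracket11_self X : bracket11 X X = br X (J X).
Proof.
rewrite /bracket11 (br_anti (J X)) opprK -mulr2n -(scaler_nat 2 (br X _)) scalerA.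
by rewrite mulVf ?scale1r // pnatr_eq0.
Qed.

Let b (m : 'I_n) X Y : R := g (bracket11 X Y) (e m).

Let bB m : bilinear_form (b m).
Proof.
by split=> [X|Y] a U V; rewrite /b ?bracket11_linearr ?bracket11_linearl !gE.
Qed.

Definition metric (U : state) X Y : R := g X Y + 2^-1 * \sum_m U m * b m X Y.

Lemma metric_form U : bilinear_form (metric U).
Proof.
have sumE (h1 h2 h3 : 'I_n -> R) (a : R) : (forall m, h1 m = a * h2 m + h3 m) ->
    \sum_m U m * h1 m = a * (\sum_m U m * h2 m) + \sum_m U m * h3 m.
  move=> E; rewrite mulr_sumr -big_split; apply: eq_bigr => m _ /=.
  by rewrite E; ring.
split=> [X|Y] a V W; rewrite /metric !gE.
  by rewrite (sumE _ (fun m => b m X V) (fun m => b m X W) a) => [|m];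
    rewrite ?(formE (bB m)); ring.
by rewrite (sumE _ (fun m => b m V Y) (fun m => b m W Y) a) => [|m];
  rewrite ?(formE (bB m)); ring.
Qed.

Lemma metricC U X Y : metric U X Y = metric U Y X.
Proof.
rewrite /metric sg; congr (_ + _ * _); apply: eq_bigr => m _.
by rewrite /b bracket11C.
Qed.

Lemma metricJ U X Y : metric U (J X) (J Y) = metric U X Y.
Proof.
rewrite /metric gJ; congr (_ + _ * _); apply: eq_bigr => m _.
by rewrite /b bracket11J.
Qed.

Lemma metric0 X Y : metric (fun=> 0) X Y = g X Y.
Proof. by rewrite /metric big1 ?mulr0 ?addr0 // => m _; rewrite mul0r. Qed.

(** Brackets and their J-images are central, so the correction to g vanishes on them. The Ricci form
    of g_U thus depends on U only through the orthonormal frame. *)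
Lemma metric_br U X Y Z : metric U (br X Y) Z = g (br X Y) Z.
Proof.
rewrite /metric big1 ?mulr0 ?addr0 // => m _.
by rewrite /b /bracket11 br_br br_Jbr subrr scaler0 !gE mulr0.
Qed.

(** The factor 1/2 leaves room for negative times, while g_U-orthonormal vectors keep g-norm squared
    at most 2. *)
Definition admissible (U : state) : Prop := forall X, 2^-1 * g X X <= metric U X X.

Lemma metric_g_ge0 X : 0 <= g X X.
Proof. by have [->|/pg/ltW//] := eqVneq X 0; rewrite !gE. Qed.

Lemma admissible_pos U X : admissible U -> X != 0 -> 0 < metric U X X.
Proof. by move=> KU /pg X0; apply: lt_le_trans (KU X); rewrite mulr_gt0 ?invr_gt0. Qed.

Lemma frame_exists : exists fr : state -> 'I_n -> L,
  forall U, admissible U -> onb (metric U) {:L}%VS (fr U).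
Proof.
suff h : forall U, exists fr : 'I_n -> L, admissible U -> onb (metric U) {:L}%VS fr.
  by have [fr hfr] := choice h; exists fr.
move=> U; have [KU|nKU] := pselect (admissible U); last by exists (fun=> 0).
have [|fr hfr] := onb_exists (F := {:L}%VS) (metric_form U) (metricC U).
  by move=> X _; exact: admissible_pos.
by exists fr.
Qed.

Lemma b_bound : exists2 B : R, 0 <= B &
  forall m X Y, `|b m X Y| <= B * (g X X + g Y Y).
Proof.
pose B := \sum_m \sum_i \sum_j `|b m (e i) (e j)|.
exists B; first by rewrite !sumr_ge0 // => m _; rewrite sumr_ge0 // => i _; rewrite sumr_ge0.
move=> m X Y; have [_ _ eX] := he.
have coordle Z i : g Z (e i) ^+ 2 <= g Z Z.
  rewrite (onb_parseval hg he (memvf Z) (memvf Z) sg) (bigD1 i) //= -expr2 lerDl.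
  by apply: sumr_ge0 => j _; rewrite -expr2 sqr_ge0.
have s0 : 0 <= g X X + g Y Y by rewrite addr_ge0 ?metric_g_ge0.
have -> : b m X Y = \sum_i \sum_j g X (e i) * g Y (e j) * b m (e i) (e j).
  rewrite {1}(eX _ (memvf X)) form_suml //; apply: eq_bigr => i _.
  rewrite formZl // {1}(eX _ (memvf Y)) form_sumr // mulr_sumr.
  by apply: eq_bigr => j _; rewrite formZr // mulrA.
apply: le_trans (ler_norm_sum _ _ _) _.
apply: (le_trans (y := \sum_i \sum_j `|b m (e i) (e j)| * (g X X + g Y Y))).
  apply: ler_sum => i _; apply: le_trans (ler_norm_sum _ _ _) _.
  apply: ler_sum => j _; rewrite normrM mulrC ler_wpM2l //.
  rewrite ler_norml; have := coordle X i; have := coordle Y j.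
  have := sqr_ge0 (g X (e i) + g Y (e j)); have := sqr_ge0 (g X (e i) - g Y (e j)).
  by have := metric_g_ge0 X; have := metric_g_ge0 Y; move=> *; apply/andP; split; nra.
under eq_bigr => i _ do rewrite -mulr_suml.
rewrite -mulr_suml ler_wpM2r // /B [leRHS](bigD1 m) //= lerDl.
by apply: sumr_ge0 => k _; apply: sumr_ge0 => i _; apply: sumr_ge0.
Qed.

Lemma is_derive_sum (h dh : 'I_n -> R -> R) (t : R) :
  (forall m, is_derive t (1 : R) (h m) (dh m t)) ->
  is_derive t (1 : R) (fun s => \sum_m h m s) (\sum_m dh m t).
Proof.
move=> hd; elim: (index_enum _) => [|m s IH].
  rewrite big_nil (_ : (fun s => _) = fun=> 0); first exact: is_derive_cst.
  by apply/funext => s; rewrite big_nil.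
rewrite big_cons (_ : (fun s => _) = fun r => h m r + \sum_(j <- s) h j r).
  exact: is_deriveD.
by apply/funext => r; rewrite big_cons.
Qed.

Lemma metric_sub U V X Y B : (forall m, `|b m X Y| <= B) ->
  `|metric V X Y - metric U X Y| <= 2^-1 * B * \sum_m `|U m - V m|.
Proof.
move=> hB.
have -> : metric V X Y - metric U X Y = 2^-1 * \sum_m (V m - U m) * b m X Y.
  rewrite /metric opprD addrACA subrr add0r -mulrBr -sumrB; congr (_ * _).
  by apply: eq_bigr => m _; rewrite mulrBl.
rewrite normrM ger0_norm ?invr_ge0 // -mulrA ler_wpM2l ?invr_ge0 // mulr_sumr.
apply: le_trans (ler_norm_sum _ _ _) _; apply: ler_sum => m _.
by rewrite normrM distrC mulrC ler_wpM2r.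
Qed.

(** Expanding both traces in the two bases at once displays the difference of the metrics as a
    factor. This makes the trace Lipschitz in the metric without any regularity in the choice of
    frames. *)
Lemma contraction_sub m U V (u v : 'I_n -> L) :
  onb (metric U) {:L}%VS u -> onb (metric V) {:L}%VS v ->
  \sum_i b m (u i) (u i) - \sum_i b m (v i) (v i) =
  \sum_k \sum_l (metric V (u k) (v l) - metric U (u k) (v l)) * b m (u k) (v l).
Proof.
move=> [_ _ uX] [_ _ vX].
under [RHS]eq_bigr => k _ do under eq_bigr => l _ do rewrite mulrBl.
under [RHS]eq_bigr => k _ do rewrite sumrB.
rewrite sumrB; congr (_ - _).
  apply: eq_bigr => k _; rewrite {2}(vX _ (memvf (u k))) form_sumr //.
  by apply: eq_bigr => l _; rewrite formZr.
rewrite exchange_big; apply: eq_bigr => l _ /=.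
rewrite {1}(uX _ (memvf (v l))) form_suml //.
by apply: eq_bigr => k _; rewrite formZl // metricC.
Qed.

Theorem pluriclosed_flow_exists : exists2 eps : R, 0 < eps &
  exists w : R -> L -> L -> R,
    pluriclosed_flow br J `](- eps), +oo[ w /\
    forall X Y, w 0 X Y = fundamental_form J g X Y.
Proof.
have [fr hfr] := frame_exists; have [B B0 hB] := b_bound.
(* Since b m X X = g([X, JX], e m), these are the coordinates in [e] of the vector S for g_U. *)
pose f (U : state) : state := fun m => \sum_i b m (fr U i) (fr U i).
(* Frame vectors have g-norm squared at most 2, so |b m| <= 4 B on them, and M bounds f. In C there
   are n^2 terms, each at most (2 B)(4 B) times the distance. The constant k bounds the derivative
   of q below by k g(X, X), and k eps <= 1. *)
pose M : R := n%:R * (4 * B); pose C : R := n%:R * n%:R * (8 * B ^+ 2).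
pose k : R := 2 * n%:R * M * B.
have k0 : 0 <= k by rewrite /k /M !mulr_ge0.
pose eps : R := (k + 1)^-1.
have eps0 : 0 < eps by rewrite invr_gt0 ltr_wpDl.
have frle U i : admissible U -> g (fr U i) (fr U i) <= 2.
  move=> KU; have [_ fo _] := hfr _ KU.
  by have := KU (fr U i); rewrite fo eqxx /=; lra.
have b4 m U V i j : admissible U -> admissible V -> `|b m (fr U i) (fr V j)| <= 4 * B.
  move=> KU KV; apply: le_trans (hB _ _ _) _; rewrite mulrC ler_wpM2r //.
  by have := frle _ i KU; have := frle _ j KV; lra.
have fE U X Y : \sum_m f U m * b m X Y =
    g (\sum_i br (fr U i) (J (fr U i))) (bracket11 X Y).
  rewrite (onb_parseval hg he (memvf _) (memvf _) sg); apply: eq_bigr => m _.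
  congr (_ * _); rewrite /f form_suml //; apply: eq_bigr => i _.
  by rewrite /b bracket11_self.
have dV (V : R -> state) U t X Y :
    (forall m, is_derive t (1 : R) (fun s => V s m) (f U m)) ->
    is_derive t (1 : R) (fun s => \sum_m V s m * b m X Y)
      (g (\sum_i br (fr U i) (J (fr U i))) (bracket11 X Y)).
  move=> hV; rewrite -fE; apply: is_derive_sum => m.
  have := is_deriveZ (b m X Y) (hV m); rewrite /GRing.scale /= => h.
  rewrite (_ : (fun s => V s m * b m X Y) = (fun s => b m X Y * V s m)).
    by rewrite mulrC; apply: h.
  by apply/funext => s; rewrite mulrC.
have [|||||||U [U0 KU dU]] := @picard_lindelof R n admissible f C M eps.
- by [].
- by rewrite /C !mulr_ge0 // sqr_ge0.
- move=> X; rewrite metric0; have := metric_g_ge0 X; lra.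
- move=> u v Ku cu X.
  have cm : metric (u j) X X @[j --> \oo] --> metric v X X.
    apply: cvgD; first exact: cvg_cst.
    apply: cvgM; first exact: cvg_cst.
    apply: cvg_big => [|m _]; first exact: add_continuous.
    by apply: cvgM; [exact: cu|exact: cvg_cst].
  rewrite -(cvg_lim _ cm) //; apply: limr_ge; first by apply/cvg_ex; eexists; exact: cm.
  by near=> j; exact: Ku.
- move=> u m Ku; apply: le_trans (ler_norm_sum _ _ _) _.
  apply: (le_trans (y := \sum_(i < n) 4 * B)).
    by apply: ler_sum => i _; exact: b4.
  by rewrite sumr_const card_ord -[leLHS]mulr_natl.
- move=> u v m Ku Kv; rewrite (contraction_sub m (hfr _ Ku) (hfr _ Kv)).
  apply: le_trans (ler_norm_sum _ _ _) _.
  pose s := \sum_j `|u j - v j|.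
  apply: (le_trans (y := \sum_(i < n) \sum_(j < n) 8 * B ^+ 2 * s)).
    apply: ler_sum => i _; apply: le_trans (ler_norm_sum _ _ _) _.
    apply: ler_sum => j _; rewrite normrM.
    have h1 := metric_sub u v (fun m => b4 m u v i j Ku Kv).
    have h2 := b4 m u v i j Ku Kv.
    apply: (le_trans (ler_pM (normr_ge0 _) (normr_ge0 _) h1 h2)).
    by rewrite le_eqVlt; apply/orP; left; apply/eqP; rewrite /s; field.
  by rewrite !sumr_const !card_ord -!mulrnA -[leLHS]mulr_natl natrM /C mulrA.
(* Here q is twice the change of the metric at (X, X), and q' = g(S, [X, JX]) >= 0 by [skt_ge0]. So
   q >= 0 for t >= 0, while for - eps <= t < 0 it drops by at most k eps g(X, X) <= g(X, X). *)
- move=> U V KU V0 dV' t ht X.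
  pose q s := \sum_m V s m * b m X X.
  pose dq s := g (\sum_i br (fr (U s) i) (J (fr (U s) i))) (bracket11 X X).
  have hq s : - eps <= s -> is_derive s (1 : R) q (dq s).
    by move=> hs; apply: dV => m; exact: dV'.
  have q0 : q 0 = 0 by rewrite /q big1 // => m _; rewrite V0 mul0r.
  have dq0 s : 0 <= dq s.
    rewrite /dq form_suml // sumr_ge0 // => i _.
    by rewrite bracket11_self; exact: skt_ge0.
  suff : - (2^-1 * g X X) <= 2^-1 * q t by rewrite /metric -/(q t); lra.
  have gX := metric_g_ge0 X.
  have [t0|t0] := leP 0 t.
    have := @derive_dominated _ (fun=> 0) q (fun=> 0) dq 0 t t0.
    rewrite subrr normr0 q0 subr0 => /(_ _ _ _)/wrap[s /andP[s0 _]|s _|h].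
    + by apply: hq; apply: le_trans s0; rewrite oppr_le0 ltW.
    + exact: dq0.
    + by lra.
  have := @derive_dominated _ q (fun s => k * g X X * s) dq (fun=> k * g X X) t 0 (ltW t0).
  have dk (s : R) : is_derive s (1 : R) (fun s => k * g X X * s) (k * g X X).
    have := is_deriveZ (k * g X X) (is_derive_id s (1 : R)).
    by rewrite /GRing.scale /= mulr1; apply.
  rewrite q0 !mulr0 !sub0r normrN => /(_ _ _ _)/wrap[s /andP[s0 _]|s /andP[s0 _]|h].
  + by apply: hq; exact: le_trans s0.
  + have hs := le_trans ht s0.
    rewrite /dq -fE; apply: le_trans (ler_norm_sum _ _ _) _.
    apply: (le_trans (y := \sum_(m < n) M * (B * (g X X + g X X)))).
      apply: ler_sum => m _; rewrite normrM; apply: ler_pM => //.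
      apply: le_trans (ler_norm_sum _ _ _) _.
      apply: (le_trans (y := \sum_(i < n) 4 * B)).
        by apply: ler_sum => i _; apply: b4; exact: KU.
      by rewrite sumr_const card_ord -[leLHS]mulr_natl.
    rewrite sumr_const card_ord -[leLHS]mulr_natl /k le_eqVlt.
    by apply/orP; left; apply/eqP; ring.
  have ke : k * eps <= 1 by rewrite ler_pdivrMr ?mul1r ?ltr_wpDl // lerDl.
  have : k * g X X * - t <= g X X.
    apply: (le_trans (y := k * eps * g X X)); last by rewrite ler_piMl.
    by rewrite mulrAC ler_wpM2r // ler_wpM2l // lerNl.
  by move: h; rewrite ler_norml -mulrN => /andP[]; lra.
exists eps => //; exists (fun t X Y => metric (U t) X (J Y)); split; last first.
  move=> X Y; rewrite /fundamental_form /metric big1 ?mulr0 ?addr0 // => m _.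
  by rewrite U0 mul0r.
move=> t; rewrite /= in_itv /= andbT => ht; have KUt := KU _ (ltW ht).
pose S := \sum_i br (fr (U t) i) (J (fr (U t) i)).
exists (metric (U t)), (fun X Y => 2^-1 * metric (U t) (br X Y) S); split.
- split; last by move=> X Y; exact: metricJ.
  split; [exact: metric_form|exact: metricC|].
  by move=> X; exact: admissible_pos.
- by [].
- apply: bismut_ricciP => //.
  + exact: metric_form.
  + exact: metricC.
  + by move=> X; exact: admissible_pos.
  + exact: metricJ.
  + exact: hfr.
move=> X Y; have h := dV U (U t) t X (J Y) (fun m => dU t m ht).
have h1 := is_deriveD (is_derive_cst (g X (J Y)) t (1 : R)) (is_deriveZ 2^-1 h).
rewrite /part11 !metric_br.
(* The (1,1)-part averages [X, Y] and [JX, JY], and their sum is -2 [bracket11 X (J Y)]. *)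
have -> : - (2^-1 * (2^-1 * g (br X Y) S + 2^-1 * g (br (J X) (J Y)) S)) =
    0 + 2^-1 *: g S (bracket11 X (J Y)).
  rewrite /GRing.scale /= /bracket11 JJ !(bE, gE) (sg S) (sg S) add0r; ring.
exact: h1.
Unshelve. all: by end_near. Qed.

End Flow.

(** * The Lie algebra of left-invariant vector fields *)

Section LieAlgebra.
Variables (R : realType) (G : topGroupType) (n : nat) (A : set (chart R G n)).
Variables (L : vectType R) (br : L -> L -> L) (xi : L -> (G -> R) -> (G -> R)).
Hypothesis hxi : lie_algebra_of A br xi.

Let smooth_xi X f : smooth_fun A f -> smooth_fun A (xi X f).
Proof. exact: field_smooth (lie_field hxi X) _. Qed.

Let xiB X f h x : smooth_fun A f -> smooth_fun A h ->
  xi X (fun y => f y - h y) x = xi X f x - xi X h x.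
Proof.
move=> sf sh; have := field_linear (lie_field hxi X) (- 1) sh sf x.
rewrite mulN1r addrC => <-; congr (xi X _ x).
by apply/funext => y; rewrite mulN1r addrC.
Qed.

Let xi_linear a X Y f : smooth_fun A f ->
  xi (a *: X + Y) f = (fun y => a * xi X f y + xi Y f y).
Proof. by move=> sf; apply/funext => y; rewrite (lie_linear hxi). Qed.

Let xi_bracket X Y f : smooth_fun A f ->
  xi (br X Y) f = (fun y => xi X (xi Y f) y - xi Y (xi X f) y).
Proof. by move=> sf; apply/funext => y; rewrite (lie_bracket hxi). Qed.

(** The identities for [br] are checked on smooth functions, where [br] is a commutator of
    derivations, and brought back to L by this faithfulness. *)
Let xi_inj X Y : (forall f, smooth_fun A f -> forall x, xi X f x = xi Y f x) -> X = Y.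
Proof.
move=> h; have : - 1 *: Y + X = 0.
  apply: (lie_injective hxi) => f sf x.
  by rewrite xi_linear // h // mulN1r addNr.
by move/eqP; rewrite scaleN1r addrC subr_eq0 => /eqP.
Qed.

Lemma lie_bracket_linearl Z : linear (br^~ Z).
Proof.
move=> a X Y; apply: xi_inj => f sf x.
rewrite (xi_linear _ _ _ sf) !(xi_bracket _ _ sf) (xi_linear _ _ _ (smooth_xi Z sf)).
rewrite (xi_linear _ _ _ sf).
rewrite (field_linear (lie_field hxi Z) _ (smooth_xi X sf) (smooth_xi Y sf)).
by ring.
Qed.

Lemma lie_bracket_anti X Y : br X Y = - br Y X.
Proof.
apply: xi_inj => f sf x.
have -> : - br Y X = (- 2) *: br Y X + br Y X.
  by rewrite -[X in _ + X]scale1r -scalerDl -scaleN1r; congr (_ *: _); ring.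
by rewrite xi_linear // !xi_bracket //; ring.
Qed.

Lemma lie_bracket_linearr X : linear (br X).
Proof.
move=> a Y Z; rewrite (lie_bracket_anti X) lie_bracket_linearl.
by rewrite (lie_bracket_anti X Y) (lie_bracket_anti X Z) opprD scalerN.
Qed.

Lemma lie_bracket_jacobi X Y Z : br X (br Y Z) = br (br X Y) Z + br Y (br X Z).
Proof.
apply: xi_inj => f sf x.
have s2 U V : smooth_fun A (xi U (xi V f)) by exact/smooth_xi/smooth_xi.
rewrite -[br (br X Y) Z]scale1r (xi_linear _ _ _ sf) !(xi_bracket _ _ sf).
rewrite !(xi_bracket _ _ (smooth_xi _ sf)) !(xiB _ _ (s2 _ _) (s2 _ _)).
by ring.
Qed.

End LieAlgebra.

(** * The theorem on nilmanifolds *)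

Unset Implicit Arguments.

Theorem theorem1p1 (R : realType) (G : topGroupType) (n : nat)
    (A : set (chart R G n)) (L : vectType R) (br : L -> L -> L)
    (xi : L -> (G -> R) -> (G -> R)) (Gam : groupClosed G)
    (J : 'End(L)) (w0 : L -> L -> R) :
  lie_group A ->
  simply_connected R G ->
  lie_algebra_of A br xi ->
  nilpotent_lie_algebra br ->
  discrete_subgroup Gam ->
  compact [set: orbit_space Gam] ->
  skt_structure br J w0 ->
  exists2 eps : R, 0 < eps &
  exists w : R -> L -> L -> R,
    pluriclosed_flow br J `](- eps), +oo[ w /\ w 0 = w0.
Proof.
move=> _ _ hxi [K lcK] _ _ [[JJ nijJ] [g [[hg sg pg] gJ] w0E] ddb].
have brl := lie_bracket_linearl hxi; have brr := lie_bracket_linearr hxi.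
have br_anti := lie_bracket_anti hxi; have jacobi := lie_bracket_jacobi hxi.
have nij X Y : br (J X) (J Y) = br X Y + J (br (J X) Y) + J (br X (J Y)).
  have := nijJ X Y; rewrite /nijenhuis => /eqP; rewrite !subr_eq add0r => /eqP ->.
  by rewrite addrAC.
have w0F : w0 = (fun X Y => g X (J Y)).
  by apply/funext => X; apply/funext => Y; rewrite w0E.
rewrite w0F in ddb.
have skt X Y : d_torsion_form br J g X Y = 0.
  exact: (d_torsion_form_eq0 brl brr br_anti JJ nij hg sg gJ).
pose lc := lower_central br.
have lc0 X : X \in lc 0 by exact: memvf.
have lcS i X Y : Y \in lc i -> br X Y \in lc i.+1.
  by move=> Yi; apply: (mem_bracket_span brl brr) => //; exact: memvf.
have lcK0 X : X \in lc K -> X = 0 by rewrite /lc lcK memv0 => /eqP.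
have sub : subalgebra br J {:L}%VS by split=> *; exact: memvf.
have L2 : two_step br {:L}%VS.
  exact: (nilpotent_skt_two_step brl brr br_anti jacobi lc0 lcS lcK0 JJ nij hg sg pg gJ skt).
have z1 X Y Z : br (br X Y) Z = 0 by rewrite br_anti L2 ?oppr0 ?memvf.
have z2 X Y Z : br (J (br X Y)) Z = 0.
  exact: (center_complex brl brr br_anti jacobi lc0 lcS lcK0 JJ nij hg pg gJ skt sub
    (memvf _) (fun W _ => z1 X Y W) (memvf Z)).
(* By [two_step_skt], twice this number is a sum of four squared norms. *)
have pos X Y : 0 <= g (br X (J X)) (br Y (J Y)).
  have g0 Z : 0 <= g Z Z by have [->|/pg/ltW//] := eqVneq Z 0; rewrite form0l.
  have := two_step_skt brl brr br_anti jacobi lc0 lcS lcK0 JJ nij hg sg pg gJ skt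
    sub L2 (memvf X) (memvf Y).
  have := g0 (br X Y); have := g0 (br X (J Y)).
  by have := g0 (br (J X) Y); have := g0 (br (J X) (J Y)); lra.
have [e he] : exists e : 'I_(\dim {:L}) -> L, onb g {:L}%VS e.
  by apply: onb_exists => // X _; exact: pg.
have [eps eps0 [w [flow w00]]] :=
  pluriclosed_flow_exists brl brr br_anti JJ nij hg sg pg gJ z1 z2 pos he.
exists eps => //; exists w; split=> //; rewrite w0F.
by apply/funext => X; apply/funext => Y; rewrite w00.
Qed.
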